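(* There exists an absolute constant $c>0$ such that for every $\alpha\in(0,1)$ there exists $n_0\in\mathbb{N}$ such that the following holds for every $n\ge n_0$. There exists a permutation $\sigma\in S_n$ whose conjugacy class $\sigma^{S_n}$ has density $\frac{|\sigma^{S_n}|}{n!}\ge n^{-2\alpha n^{\alpha}}$, such that for every irreducible character $\chi$ of $S_n$ of level $d\le 0.5\,\alpha n^{\alpha}$ we have $$\left|\frac{\chi(\sigma)}{\chi(1)}\right|\ge n^{d(\alpha-1)}(c\alpha)^{d}.$$
   Context: $S_n$ is the symmetric group on $n$ letters, and irreducible characters are the complex irreducible characters $\chi_\lambda$ indexed by partitions $\lambda=(\lambda_1\ge\lambda_2\ge\cdots)$ of $n$. Write $\lambda'$ for the conjugate partition (transposed Young diagram), so $\lambda_1'$ is the number of parts of $\lambda$. The level of $\chi_\lambda$ is $\min(n-\lambda_1,\,n-\lambda_1')$. *)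

(* Defs.v *)
From mathcomp Require Import all_boot all_order all_algebra all_fingroup.
From mathcomp Require Import all_field all_character.
From mathcomp Require Import boolp classical_sets reals exp.
Set Implicit Arguments.
Unset Strict Implicit.
Unset Printing Implicit Defensive.
Import Order.TTheory GRing.Theory Num.Theory.
Local Open Scope ring_scope.

Definition is_partition (n : nat) (la : seq nat) : bool :=
  [&& sorted geq la, all (leq 1) la & sumn la == n].

(* Row and column stabilizers of the Young tableau of shape [la] whose cells
   are filled with 0, ..., n-1 row by row: the entry [k] lies in row
   [reshape_index la k] and in column [reshape_offset la k]. *)
Definition row_stab (n : nat) (la : seq nat) : {set 'S_n} :=
  [set s : 'S_n |
     [forall k : 'I_n, reshape_index la (s k) == reshape_index la k]].

Definition col_stab (n : nat) (la : seq nat) : {set 'S_n} :=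
  [set s : 'S_n |
     [forall k : 'I_n, reshape_offset la (s k) == reshape_offset la k]].

(* The Young symmetrizer, i.e. the sum of sgn(q) p q for p in the row stabilizer
   and q in the column stabilizer, as a vector of the group algebra of S_n: the
   basis vector of the regular representation attached to g is
   [delta_mx 0 (gring_index _ g)], and g acts on row vectors by right
   multiplication. *)
Definition young_symmetrizer (n : nat) (la : seq nat) :
    'rV[algC]_#|[set: 'S_n]%G| :=
  \sum_(p in row_stab n la) \sum_(q in col_stab n la)
     (-1) ^+ odd_perm q *: delta_mx 0 (gring_index [set: 'S_n]%G (p * q)%g).

(* The Specht module as the right ideal generated by the Young symmetrizer. *)
Definition specht_repr (n : nat) (la : seq nat) :=
  submod_repr (cyclic_mx_module (regular_repr algC [set: 'S_n]%G)
                                (young_symmetrizer n la)).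

Definition specht_char (n : nat) (la : seq nat) : 'CF([set: 'S_n]%G) :=
  cfRepr (specht_repr n la).

(* [head 0 la] is the largest part of [la]; [size la] is the number of its
   parts, i.e. the largest part of the conjugate partition. *)
Definition partition_level (n : nat) (la : seq nat) : nat :=
  minn (n - head 0%N la) (n - size la).

Definition has_level (n : nat) (chi : 'CF([set: 'S_n]%G)) (d : nat) : Prop :=
  exists la : seq nat,
    [/\ is_partition n la, chi = specht_char n la & d = partition_level n la].

(* The real number equal to a real algebraic number [z], obtained as the
   supremum of its rational lower bounds ([algC] comes with no embedding into
   an arbitrary [realType]). Only meaningful when [z] is real. *)
Definition real_of_algC (R : realType) (z : algC) : R :=
  sup [set x : R | exists2 q : rat, ratr q <= z & x = ratr q]%classic.

Lemma real_of_algC_rat (R : realType) (q : rat) :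
  real_of_algC R (ratr q) = ratr q.
Proof.
apply/eqP; rewrite eq_le; apply/andP; split.
  apply: ge_sup; first by exists (ratr q); exists q.
  by move=> _ [p + ->]; rewrite !ler_rat.
apply: ub_le_sup; last by exists q.
by exists (ratr q) => _ [p + ->]; rewrite !ler_rat.
Qed.

(* Main.v *)
Require Import Defs.
From mathcomp Require Import boolp classical_sets reals exp.
From mathcomp Require Import all_boot all_order all_algebra all_fingroup.
From mathcomp Require Import all_field all_character.
From mathcomp Require Import ring lra zify.

(** Take sigma to be the product of f fixed points and one cycle of length
    n - f, with f close to 2 alpha n^alpha.  Its centralizer has at most f^f n
    elements, which gives the density of its class.

    For the characters, let pi(g, t), for g in S_n and t in S_k, be the number
    of injections a from k letters to n letters with g a = a t.  A function u
    on S_k yields the function [ind_level n u] on S_n, obtained by averaging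
    u(t) pi(g, t) over t; when u is a character this is the character induced
    from u x 1 on S_k x S_(n-k).  The adjoint operation [res_level j] goes from
    functions on S_k to class functions on S_j and takes the invariants of
    S_(k-j).  The two are related by a Mackey formula, valid for k + l <= n:
      < ind u, ind v > = sum over i <= l of < res_i u, res_i v >
    ([fdot_ind_level]).  Both sides count the partial matchings between k
    letters and l letters that are invariant under a pair of permutations.  The
    right-hand side does not depend on n, and a triangular correction
      top u = ind u - sum over j < k of top (res_j u)
    ([top_level]) makes this an isometry: top u has the norm of u for a class
    function u, and different levels are orthogonal ([fdot_top_level],
    [fdot_top_orth]).

    Let chi be an irreducible character of level d.  After multiplication by
    the sign character if necessary, the pigeonhole principle in the Young
    symmetrizer shows that the underlying representation has no nonzero vector
    fixed by Sym(Y) when Y has more than n - d letters, but has one for some Y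
    with exactly n - d letters.  Hence chi is orthogonal to every [ind_level]
    from S_j with j < d, while its inner product with [ind_level] of some
    irreducible psi of S_d is a positive integer.  Two unit vectors with a
    positive integer inner product are equal, so chi = top psi
    ([primitive_top_level], [specht_top_level]).

    It remains to evaluate top psi.  When all nontrivial cycles of g are longer
    than d, only the identity t contributes to pi(g, t), so
    [ind_level] of u takes at g the value C(f, k) u(1), with f the number of
    fixed points of g; this covers both sigma and the identity.  If 4 d <= f,
    the binomials C(f, j) grow by factors of at least 3 up to j = d, and the
    corrections in the recursion are dominated ([top_level_bound]).  Hence
      (2/3)^d C(f, d) psi(1) <= |chi(sigma)|  and
      chi(1) <= 2^d C(n, d) psi(1),
    and the ratio is at least ((f - d) / (3 n))^d ([specht_ratio_ge]). *)

Set Implicit Arguments.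
Unset Strict Implicit.
Unset Printing Implicit Defensive.
Import Order.TTheory GRing.Theory Num.Theory.
Local Open Scope ring_scope.

(** * Extending partial injections and counting twisted fixed points *)

Lemma perm_extends (X : finType) (A : {set X}) (f : X -> X) :
  {in A &, injective f} -> exists g : {perm X}, {in A, g =1 f}.
Proof.
move=> injf; pose B := f @: A.
have cardB : #|~: B| = #|~: A| by rewrite [LHS]cardsCs [RHS]cardsCs !setCK card_in_imset.
pose h x := if x \in A then f x else nth x (enum (~: B)) (index x (enum (~: A))).
have hC x : x \notin A ->
    (index x (enum (~: A)) < size (enum (~: B)))%N.
  by move=> xA; rewrite -cardE cardB cardE index_mem mem_enum inE.
have hB x : (h x \in B) = (x \in A).
  rewrite /h; case: ifPn => xA; first exact: imset_f.
  apply/negbTE; rewrite -in_setC -mem_enum; exact/mem_nth/hC.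
have injh : injective h.
  move=> x y; move: (hB x) (hB y) => hBx hBy hxy; move: (hBx); rewrite hxy hBy.
  move: hxy; rewrite /h; case: ifPn => xA; case: ifPn => yA // hxy _.
    exact: injf.
  rewrite (set_nth_default x) ?hC // in hxy.
  move/eqP: hxy; rewrite nth_uniq ?enum_uniq ?hC // => /eqP ixy.
  have xs : x \in enum (~: A) by rewrite mem_enum inE.
  have ys : y \in enum (~: A) by rewrite mem_enum inE.
  by rewrite -(nth_index x xs) ixy nth_index.
by exists (perm injh) => x xA; rewrite permE /h xA.
Qed.

Lemma perm_transport (J X : finType) (u w : J -> X) :
  (forall i j, (u i == u j) = (w i == w j)) ->
  exists g : {perm X}, forall j, g (u j) = w j.
Proof.
move=> uw.
pose f x := if [pick j | u j == x] is Some j then w j else x.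
have fE j : f (u j) = w j.
  rewrite /f; case: pickP => [i /=|/(_ j)]; last by rewrite eqxx.
  by rewrite uw => /eqP.
have [|g gE] := @perm_extends X (u @: J) f.
  move=> _ _ /imsetP[i _ ->] /imsetP[j _ ->]; rewrite !fE => /eqP.
  by rewrite -uw => /eqP.
by exists g => j; rewrite gE ?fE // imset_f.
Qed.

(** A twisted Burnside lemma, for a group acting on S with orbits classified by
    p and a map t that permutes the orbits through tP.  The solutions g of
    g z = t z form a coset of the stabilizer of z whenever t preserves the orbit
    of z; summed over one orbit, they are in bijection with the group. *)
Lemma sum_card_twisted_fix (gT : finGroupType) (Z P : finType) (S : {set Z})
    (act : gT -> Z -> Z) (t : Z -> Z) (p : Z -> P) (tP : P -> P) :
  (forall z, act 1%g z = z) ->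
  (forall g h z, act (g * h)%g z = act h (act g z)) ->
  (forall g z, z \in S -> act g z \in S) ->
  (forall z, z \in S -> t z \in S) ->
  (forall z z', z \in S -> z' \in S ->
     p z = p z' <-> exists g, act g z = z') ->
  (forall z, z \in S -> p (t z) = tP (p z)) ->
  (\sum_(g : gT) #|[set z in S | act g z == t z]| =
   #|gT| * #|[set r in p @: S | tP r == r]|)%N.
Proof.
move=> act1 actM actS tS pP tp.
have actK g : cancel (act g) (act g^-1%g).
  by move=> z; rewrite -actM mulgV act1.
have actVK g : cancel (act g^-1%g) (act g).
  by move=> z; rewrite -actM mulVg act1.
under eq_bigr do rewrite -sum1dep_card big_mkcondr /=.
rewrite exchange_big /=.
rewrite (partition_big p (mem (p @: S))) /=; last by move=> z; apply: imset_f.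
rewrite -sum1dep_card big_mkcondr big_distrr /=; apply: eq_bigr => r.
case/imsetP=> z0 z0S ->{r}; case: eqP => [tp0|ntp0]; last first.
  rewrite muln0; apply: big1 => z /andP[zS /eqP pz]; apply: big1 => g _.
  case: eqP => // gz; case: ntp0.
  rewrite -pz -tp //; apply/esym; apply/(pP _ _ zS (tS z zS)).
  by exists g.
rewrite muln1.
(* Both {g | g z = t z} and {g | g z0 = z} are cosets of conjugate stabilizers. *)
transitivity (\sum_(z in S | p z == p z0) \sum_(g : gT) (act g z0 == z))%N.
  apply: eq_bigr => z /andP[zS /eqP pz].
  have [y yz] : exists y, act y z0 = z by apply/(pP _ _ z0S zS).
  have [g1 g1z] : exists g, act g z = t z.
    by apply/(pP _ _ zS (tS z zS)); rewrite tp // pz tp0.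
  rewrite (reindex_inj (mulIg g1)) (reindex_inj (mulgI y^-1%g)) /=.
  apply: eq_bigr => g _; rewrite !actM -g1z (can_eq (actK g1)).
  by rewrite -{1}yz actK.
rewrite exchange_big /= -sum1_card; apply: eq_bigr => g _.
have gS : act g z0 \in S by apply: actS.
have pg : p (act g z0) == p z0.
  by apply/eqP/esym; apply/(pP _ _ z0S gS); exists g.
rewrite (bigD1 (act g z0)) ?gS //= eqxx big1 // => z /andP[_ zg].
by rewrite eq_sym (negbTE zg).
Qed.

(** * Intertwining injections and partial matchings *)

Definition intertwiners (I X : finType) (g : {perm X}) (t : {perm I}) :
    {set {ffun I -> X}} :=
  [set a : {ffun I -> X} | injectiveb a & [forall i, g (a i) == a (t i)]].

Lemma intertwinersP (I X : finType) (g : {perm X}) (t : {perm I})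
    (a : {ffun I -> X}) :
  reflect (injective a /\ forall i, g (a i) = a (t i)) (a \in intertwiners g t).
Proof.
rewrite inE; apply: (iffP andP) => -[aI aE]; split; first exact/injectiveP.
- by move=> i; apply/eqP/(forallP aE).
- exact/injectiveP.
- by apply/forallP=> i; apply/eqP.
Qed.

(** The graph of a partial injection from I to J. *)
Definition matching (I J : finType) (r : {set I * J}) : bool :=
  [forall x in r, forall y in r, (x.1 == y.1) == (x.2 == y.2)].

Lemma matchingP (I J : finType) (r : {set I * J}) :
  reflect {in r &, forall x y, (x.1 == y.1) = (x.2 == y.2)} (matching r).
Proof.
apply: (iffP forall_inP) => [H x y xr yr|H x xr].
  by have /forall_inP/(_ y yr)/eqP := H x xr.
by apply/forall_inP => y yr; rewrite (H x y).
Qed.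

Definition relabel (I J : finType) (s : {perm I}) (t : {perm J})
  (r : {set I * J}) : {set I * J} := [set x | (s x.1, t x.2) \in r].

(** A pair of injections of I and J into X is determined, up to a permutation
    of X, by the matching formed by the coincidences between their values; the
    bound on #|X| makes every matching occur. *)
Lemma sum_intertwiners_big (I J X : finType) (s : {perm I}) (t : {perm J}) :
  (#|I| + #|J| <= #|X|)%N ->
  (\sum_(g : {perm X}) #|intertwiners g s| * #|intertwiners g t| =
   #|{perm X}| * #|[set r : {set I * J} | matching r & relabel s t r == r]|)%N.
Proof.
move=> leIJX.
pose Z := ({ffun I -> X} * {ffun J -> X})%type.
pose S : {set Z} := [set z : Z | injectiveb z.1 & injectiveb z.2].
pose act (g : {perm X}) (z : Z) : Z :=
  ([ffun i => g (z.1 i)], [ffun j => g (z.2 j)]).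
pose tw (z : Z) : Z := ([ffun i => z.1 (s i)], [ffun j => z.2 (t j)]).
pose p (z : Z) : {set I * J} := [set x | z.1 x.1 == z.2 x.2].
have SP (z : Z) : reflect (injective z.1 /\ injective z.2) (z \in S).
  by rewrite inE; apply: (iffP andP) => -[? ?]; split; apply/injectiveP.
have pS : p @: S = [set r | matching r].
  apply/setP=> r; rewrite inE; apply/imsetP/idP.
    case=> z /SP[i1 i2 ->]; apply/matchingP => x y; rewrite !inE => /eqP xz /eqP yz.
    by rewrite -(inj_eq i1) xz yz (inj_eq i2).
  move/matchingP=> mr.
  (* I goes to the first #|I| points of X; the unmatched points of J go to
     the next ones. *)
  have lt1 (i : I) : (enum_rank i < #|X|)%N.
    by apply: leq_trans leIJX; apply: ltn_addr.
  have lt2 (j : J) : (#|I| + enum_rank j < #|X|)%N.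
    by apply: leq_trans leIJX; rewrite ltn_add2l.
  pose a i := enum_val (Ordinal (lt1 i)).
  pose b j := if [pick i | (i, j) \in r] is Some i then a i
              else enum_val (Ordinal (lt2 j)).
  have ia : injective a.
    by move=> i i' /enum_val_inj[/val_inj/enum_rank_inj].
  have bE i j : (i, j) \in r -> b j = a i.
    rewrite /b; case: pickP => [i' i'r ir|/(_ i)->//].
    have := mr _ _ ir i'r; rewrite /= eqxx => /eqP ->//.
  have ab i j : (a i == b j) = ((i, j) \in r).
    apply/eqP/idP => [|/bE->//]; rewrite /b; case: pickP => [i' + /ia-> //|_].
    move/enum_val_inj => [] E; have := ltn_ord (enum_rank i); rewrite E.
    by rewrite ltnNge leq_addr.
  have ib : injective b.
    move=> j j'; rewrite {1}/b; case: pickP => [i ir /eqP|n1].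
      rewrite ab => ir'; have := mr _ _ ir ir'; rewrite /= eqxx.
      by move/esym/eqP.
    rewrite /b; case: pickP => [i ir|n2] /enum_val_inj[].
      move=> E; have := ltn_ord (enum_rank i); rewrite -E.
      by rewrite ltnNge leq_addr.
    by move/eqP; rewrite eqn_add2l => /eqP/val_inj/enum_rank_inj.
  exists ([ffun i => a i], [ffun j => b j]).
    by apply/SP; split=> x y; rewrite !ffunE; [move/ia|move/ib].
  by apply/setP=> -[i j]; rewrite inE /= !ffunE ab.
have <- : [set r in p @: S | relabel s t r == r] =
          [set r | matching r & relabel s t r == r].
  by apply/setP=> r; rewrite pS !inE.
rewrite -(@sum_card_twisted_fix _ Z _ S act tw p) //.
- apply: eq_bigr => g _; rewrite -cardsX; apply: eq_card => -[a b].
  rewrite !inE -!andbA /=; congr (_ && _); rewrite andbCA; congr (_ && _).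
  rewrite xpair_eqE; congr (_ && _).
    apply/forallP/eqP => [H|/ffunP H i].
      by apply/ffunP=> i; rewrite !ffunE; apply/eqP.
    by have := H i; rewrite !ffunE => ->.
  apply/forallP/eqP => [H|/ffunP H i].
    by apply/ffunP=> i; rewrite !ffunE; apply/eqP.
  by have := H i; rewrite !ffunE => ->.
- by move=> [a b]; congr pair; apply/ffunP=> i; rewrite !ffunE perm1.
- by move=> g h [a b]; congr pair; apply/ffunP=> i; rewrite !ffunE permM.
- move=> g z /SP[i1 i2]; apply/SP; split=> x y; rewrite !ffunE => /perm_inj.
    exact: i1.
  exact: i2.
- move=> z /SP[i1 i2]; apply/SP; split=> x y; rewrite !ffunE.
    by move/i1/perm_inj.
  by move/i2/perm_inj.
- move=> z z' /SP[i1 i2] /SP[i1' i2']; split=> [pzz|[g <-]]; last first.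
    by apply/setP=> x; rewrite !inE !ffunE (inj_eq perm_inj).
  pose u (x : I + J) := match x with inl i => z.1 i | inr j => z.2 j end.
  pose w (x : I + J) := match x with inl i => z'.1 i | inr j => z'.2 j end.
  have [|g gE] := @perm_transport _ X u w.
    move=> [i|j] [i'|j'] /=.
    + by rewrite (inj_eq i1) (inj_eq i1').
    + by have /setP/(_ (i, j')) := pzz; rewrite !inE.
    + have /setP/(_ (i', j)) := pzz; rewrite !inE /=.
      by rewrite ![_ == z.1 _]eq_sym ![_ == z'.1 _]eq_sym eq_sym => ->; rewrite eq_sym.
    + by rewrite (inj_eq i2) (inj_eq i2').
  exists g; rewrite [RHS]surjective_pairing; congr pair.
    by apply/ffunP=> i; rewrite ffunE (gE (inl i)).
  by apply/ffunP=> j; rewrite ffunE (gE (inr j)).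
- by move=> z _; apply/setP=> x; rewrite !inE !ffunE.
Qed.

(** A pair of injections of L into I and J is determined, up to a permutation of
    L, by the matching of size #|L| that it parametrizes. *)
Lemma sum_intertwiners_small (I J L : finType) (s : {perm I}) (t : {perm J}) :
  (\sum_(k : {perm L}) #|intertwiners s k| * #|intertwiners t k| =
   #|{perm L}| * #|[set r : {set I * J} |
     [&& matching r, #|r| == #|L| & relabel s t r == r]]|)%N.
Proof.
pose Z := ({ffun L -> I} * {ffun L -> J})%type.
pose S : {set Z} := [set z : Z | injectiveb z.1 & injectiveb z.2].
pose act (k : {perm L}) (z : Z) : Z :=
  ([ffun l => z.1 (k^-1%g l)], [ffun l => z.2 (k^-1%g l)]).
pose tw (z : Z) : Z :=
  ([ffun l => s^-1%g (z.1 l)], [ffun l => t^-1%g (z.2 l)]).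
pose p (z : Z) : {set I * J} := [set (z.1 l, z.2 l) | l : L].
have SP (z : Z) : reflect (injective z.1 /\ injective z.2) (z \in S).
  by rewrite inE; apply: (iffP andP) => -[? ?]; split; apply/injectiveP.
have injp (z : Z) : injective z.1 -> injective (fun l => (z.1 l, z.2 l) : I * J).
  by move=> i1 l l' [] /i1.
have pS : p @: S = [set r | matching r & #|r| == #|L|].
  apply/setP=> r; rewrite inE; apply/imsetP/andP.
    case=> z /SP[i1 i2 ->]; split; last by rewrite card_imset //; apply: injp.
    apply/matchingP => x y /imsetP[l _ ->] /imsetP[l' _ ->] /=.
    by rewrite (inj_eq i1) (inj_eq i2).
  case=> /matchingP mr /eqP cr.
  have f0 (l : L) : 'I_#|r| by rewrite cr; exact: enum_rank l.
  pose f (l : L) := enum_val (cast_ord (esym cr) (enum_rank l)).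
  have fr l : f l \in r by apply: enum_valP.
  have fI : injective f.
    by move=> l l' /enum_val_inj/cast_ord_inj/enum_rank_inj.
  have sj x : x \in r -> exists l, f l = x.
    move=> xr; exists (enum_val (cast_ord cr (enum_rank_in xr x))).
    by rewrite /f enum_valK cast_ordK enum_rankK_in.
  exists ([ffun l => (f l).1], [ffun l => (f l).2]).
    apply/SP; split=> l l'; rewrite !ffunE => E; apply: fI.
      have := mr _ _ (fr l) (fr l'); rewrite E eqxx => /esym/eqP E2.
      by rewrite [f l]surjective_pairing [f l']surjective_pairing E E2.
    have := mr _ _ (fr l) (fr l'); rewrite E eqxx => /eqP E2.
    by rewrite [f l]surjective_pairing [f l']surjective_pairing E E2.
  apply/setP=> x; apply/idP/imsetP => [/sj[l <-]|[l _ ->]].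
    by exists l; rewrite ?inE // !ffunE -surjective_pairing.
  by rewrite !ffunE -surjective_pairing.
have <- : [set r in p @: S | relabel s t r == r] =
  [set r : {set I * J} | [&& matching r, #|r| == #|L| & relabel s t r == r]].
  by apply/setP=> r; rewrite pS !inE andbA.
rewrite -(@sum_card_twisted_fix _ Z _ S act tw p) //.
- apply: eq_bigr => k _; rewrite -cardsX; apply: eq_card => -[a b].
  rewrite !inE -!andbA /=; congr (_ && _); rewrite andbCA; congr (_ && _).
  rewrite xpair_eqE; congr (_ && _).
    apply/forallP/eqP => [H|/ffunP H l].
      apply/ffunP=> l; rewrite !ffunE; apply: (@perm_inj _ s).
      by rewrite (eqP (H _)) !permKV.
    by have := H (k l); rewrite !ffunE permK => ->; rewrite permKV.
  apply/forallP/eqP => [H|/ffunP H l].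
    apply/ffunP=> l; rewrite !ffunE; apply: (@perm_inj _ t).
    by rewrite (eqP (H _)) !permKV.
  by have := H (k l); rewrite !ffunE permK => ->; rewrite permKV.
- by move=> [a b]; congr pair; apply/ffunP=> i; rewrite !ffunE invg1 perm1.
- by move=> g h [a b]; congr pair; apply/ffunP=> i; rewrite !ffunE invMg permM.
- move=> g z /SP[i1 i2]; apply/SP; split=> x y; rewrite !ffunE.
    by move/i1/perm_inj.
  by move/i2/perm_inj.
- move=> z /SP[i1 i2]; apply/SP; split=> x y; rewrite !ffunE => /perm_inj.
    exact: i1.
  exact: i2.
- move=> z z' /SP[i1 i2] /SP[i1' i2']; split=> [pzz|[g <-]]; last first.
    apply/setP=> x; apply/imsetP/imsetP => -[l _ ->].
      by exists (g l); rewrite ?inE // !ffunE permK.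
    by exists (g^-1%g l); rewrite ?inE // !ffunE.
  have ex l : exists l', (z.1 l, z.2 l) == (z'.1 l', z'.2 l').
    have : (z.1 l, z.2 l) \in p z' by rewrite -pzz; apply: imset_f.
    by case/imsetP=> l' _ ->; exists l'.
  pose k l := xchoose (ex l).
  have kE l : (z.1 l, z.2 l) = (z'.1 (k l), z'.2 (k l)) by apply/eqP/(xchooseP (ex l)).
  have kI : injective k.
    by move=> l l' E; apply: (injp _ i1); rewrite kE E -kE.
  exists (perm kI); rewrite [RHS]surjective_pairing; congr pair.
    apply/ffunP=> l; rewrite ffunE; have [-> _] := kE ((perm kI)^-1%g l).
    by rewrite -[k _](permE kI) permKV.
  apply/ffunP=> l; rewrite ffunE; have [_ ->] := kE ((perm kI)^-1%g l).
  by rewrite -[k _](permE kI) permKV.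
- move=> z _; apply/setP=> -[i j]; rewrite !inE /=; apply/imsetP/imsetP.
    by case=> l _ []; rewrite !ffunE => -> ->; exists l; rewrite ?inE // !permKV.
  by case=> l _ [] E1 E2; exists l; rewrite ?inE // !ffunE -E1 -E2 !permK.
Qed.

(** * Moving functions between symmetric groups *)

Lemma matching_card (I J : finType) (r : {set I * J}) :
  matching r -> (#|r| <= #|J|)%N.
Proof.
move/matchingP=> mr; rewrite -(@card_in_imset _ _ (fun x => x.2) (mem r)).
  exact: max_card.
move=> [i j] [i' j'] xr yr /= jj; have := mr _ _ xr yr; rewrite /= jj eqxx.
by move=> /eqP ->.
Qed.

Lemma invf_nat_cancel n (x : nat) :
  (n`!%:R)^-1 * (n`! * x)%:R = x%:R :> algC.
Proof. by rewrite natrM mulKf // pnatr_eq0 -lt0n fact_gt0. Qed.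

(** The kernel identity behind the Mackey formula: both sides are the number of
    matchings between k and l letters invariant under (s, t), the right-hand
    side sorting them by size. *)
Lemma intertwiners_gram k l n (s : 'S_k) (t : 'S_l) : (k + l <= n)%N ->
  (n`!%:R)^-1 *
    (\sum_(g : 'S_n) #|intertwiners g s| * #|intertwiners g t|)%N%:R
  = \sum_(i < l.+1) (i`!%:R)^-1 *
      (\sum_(h : 'S_i) #|intertwiners s h| * #|intertwiners t h|)%N%:R :> algC.
Proof.
move=> kln; rewrite sum_intertwiners_big ?card_ord // card_Sn invf_nat_cancel.
under eq_bigr => i _ do
  rewrite sum_intertwiners_small card_Sn invf_nat_cancel card_ord.
rewrite -natr_sum; congr _%:R; rewrite -sum1_card.
rewrite (partition_big (fun r : {set _} => inord #|r| : 'I_l.+1) predT) //=.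
apply: eq_bigr => i _; rewrite -sum1_card; apply: eq_bigl => r.
rewrite !inE -andbA; case mr : (matching r) => //=; rewrite andbC; congr (_ && _).
by rewrite -val_eqE /= inordK //; have := matching_card mr; rewrite card_ord ltnS.
Qed.

Definition fdot n (u v : 'S_n -> algC) : algC :=
  (n`!%:R)^-1 * \sum_g u g * (v g)^*.

(** For a class function u this is the function induced from u x 1 on
    S_k x S_(n-k); [res_level] below has the transposed kernel. *)
Definition ind_level k n (u : 'S_k -> algC) (g : 'S_n) : algC :=
  (k`!%:R)^-1 * \sum_s u s * #|intertwiners g s|%:R.

Definition res_level k j (u : 'S_k -> algC) (h : 'S_j) : algC :=
  (k`!%:R)^-1 * \sum_s u s * #|intertwiners s h|%:R.

Arguments ind_level {k} n u g.
Arguments res_level {k} j u h.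

Lemma sum_kernels (A B C : finType) (c d : nat) (u : A -> algC) (v : B -> algC)
    (K : C -> A -> nat) (L : C -> B -> nat) :
  \sum_x (c%:R^-1 * \sum_a u a * (K x a)%:R) *
         (d%:R^-1 * \sum_b v b * (L x b)%:R)^* =
  c%:R^-1 * d%:R^-1 * \sum_a \sum_b u a * (v b)^* *
    (\sum_x K x a * L x b)%N%:R.
Proof.
transitivity (\sum_x \sum_a \sum_b c%:R^-1 * d%:R^-1 *
   (u a * (v b)^* * (K x a * L x b)%N%:R)).
  apply: eq_bigr => x _.
  rewrite rmorphM fmorphV rmorph_nat rmorph_sum mulrACA big_distrlr /= big_distrr.
  apply: eq_bigr => a _; rewrite big_distrr; apply: eq_bigr => b _ /=.
  by rewrite rmorphM rmorph_nat natrM; congr (_ * _); rewrite mulrACA.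
rewrite exchange_big big_distrr; apply: eq_bigr => a _ /=.
rewrite exchange_big big_distrr; apply: eq_bigr => b _ /=.
by rewrite natr_sum !big_distrr.
Qed.

(** A Mackey formula whose right-hand side does not involve n. *)
Lemma fdot_ind_level k l n (u : 'S_k -> algC) (v : 'S_l -> algC) :
  (k + l <= n)%N ->
  fdot (ind_level n u) (ind_level n v) =
  \sum_(i < l.+1) fdot (res_level i u) (res_level i v).
Proof.
move=> kln; rewrite /fdot /ind_level /res_level sum_kernels.
under [RHS]eq_bigr => i _ do rewrite sum_kernels.
under [RHS]eq_bigr => i _ do rewrite mulrCA.
rewrite mulrCA -big_distrr; congr (_ * _); rewrite big_distrr /=.
under [RHS]eq_bigr => i _ do rewrite big_distrr.
rewrite [RHS]exchange_big; apply: eq_bigr => s _ /=.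
rewrite big_distrr /=.
under [RHS]eq_bigr => i _ do rewrite big_distrr.
rewrite [RHS]exchange_big; apply: eq_bigr => t _ /=.
rewrite mulrCA intertwiners_gram // big_distrr.
by apply: eq_bigr => i _; rewrite mulrCA.
Qed.

Lemma fdotC n (u v : 'S_n -> algC) : fdot u v = (fdot v u)^*.
Proof.
rewrite /fdot rmorphM fmorphV rmorph_nat rmorph_sum; congr (_ * _).
by apply: eq_bigr => g _; rewrite rmorphM /= conjCK mulrC.
Qed.

Lemma fdotBsuml n m (u v : 'S_n -> algC) (w : 'I_m -> 'S_n -> algC) :
  fdot (fun g => u g - \sum_(i < m) w i g) v =
  fdot u v - \sum_(i < m) fdot (w i) v.
Proof.
rewrite /fdot -big_distrr -mulrBr; congr (_ * _) => /=.
under eq_bigr => g _ do rewrite mulrBl big_distrl.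
by rewrite sumrB [in RHS]exchange_big.
Qed.

Lemma fdotBsumr n m (u v : 'S_n -> algC) (w : 'I_m -> 'S_n -> algC) :
  fdot v (fun g => u g - \sum_(i < m) w i g) =
  fdot v u - \sum_(i < m) fdot v (w i).
Proof.
rewrite fdotC fdotBsuml rmorphB rmorph_sum /= -fdotC; congr (_ - _).
by apply: eq_bigr => i _; rewrite -fdotC.
Qed.

Definition class_fun n (u : 'S_n -> algC) := forall g h : 'S_n, u (g ^ h)%g = u g.

Lemma res_level_class k j (u : 'S_k -> algC) : class_fun (res_level j u).
Proof.
move=> g h; rewrite /res_level; congr (_ * _); apply: eq_bigr => s _.
congr (_ * _%:R).
pose f (a : {ffun 'I_j -> 'I_k}) : {ffun 'I_j -> 'I_k} := [ffun i => a (h i)].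
have fI : injective f.
  move=> a b /ffunP E; apply/ffunP=> i.
  by have := E (h^-1%g i); rewrite !ffunE permKV.
rewrite -[LHS](card_imset _ fI); apply: eq_card => a; apply/imsetP/idP.
  case=> b /intertwinersP[bI bE] ->; apply/intertwinersP; split=> [x y|i].
    by rewrite !ffunE => /bI/perm_inj.
  by rewrite !ffunE bE conjgE !permM permK.
move=> /intertwinersP[aI aE]; exists [ffun i => a (h^-1%g i)].
  apply/intertwinersP; split=> [x y|i]; rewrite !ffunE.
    by move/aI/perm_inj.
  by rewrite aE conjgE !permM permK.
by apply/ffunP=> i; rewrite !ffunE permK.
Qed.

(** On functions on S_j, [res_level j] averages over conjugation. *)
Lemma res_level_id j (u : 'S_j -> algC) : class_fun u -> res_level j u =1 u.
Proof.
move=> cu h; rewrite /res_level.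
transitivity ((j`!%:R)^-1 * \sum_(b : 'S_j) u h); last first.
  by rewrite sumr_const card_Sn -[u h *+ _]mulr_natl mulKf // pnatr_eq0 -lt0n fact_gt0.
congr (_ * _).
transitivity (\sum_s \sum_(b : 'S_j | s == (h ^ b)%g) u s).
  apply: eq_bigr => s _.
  pose f (b : 'S_j) : {ffun 'I_j -> 'I_j} := [ffun i => b i].
  have fI : injective f.
    by move=> a b /ffunP E; apply/permP=> i; have := E i; rewrite !ffunE.
  have -> : #|intertwiners s h| = #|[set b : 'S_j | s == (h ^ b)%g]|.
    rewrite -[RHS](card_imset _ fI); apply: eq_card => a; apply/idP/imsetP.
      move=> /intertwinersP[aI aE]; exists (perm aI); last first.
        by apply/ffunP=> i; rewrite ffunE permE.
      rewrite inE; apply/eqP/permP=> i; rewrite conjgE !permM permE -aE.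
      by congr (s _); rewrite -[a _](permE aI) permKV.
    case=> b; rewrite inE => /eqP -> ->.
    apply/intertwinersP; split=> [x y|i]; rewrite !ffunE; first exact: perm_inj.
    by rewrite conjgE !permM permK.
  rewrite -sum1dep_card natr_sum big_distrr.
  by apply: eq_bigr => b _; exact: mulr1.
rewrite (exchange_big_dep predT) //=; apply: eq_bigr => b _.
by rewrite (big_pred1 (h ^ b)%g) // cu.
Qed.

Lemma res_level_big k j (u : 'S_k -> algC) : (k < j)%N -> res_level j u =1 (fun=> 0).
Proof.
move=> kj h; rewrite /res_level big1 ?mulr0 // => s _.
rewrite (_ : intertwiners s h = finset.set0) ?cards0 ?mulr0 //.
apply/setP=> a; rewrite in_set0; apply/negP => /intertwinersP[aI _].
by have := leq_card _ aI; rewrite !card_ord leqNgt kj.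
Qed.

Lemma eq_fdot n (u u' v v' : 'S_n -> algC) :
  u =1 u' -> v =1 v' -> fdot u v = fdot u' v'.
Proof. by move=> E F; rewrite /fdot; under eq_bigr do rewrite E F. Qed.

(** * The top level part of an induced function *)

(** The part of [ind_level n u] orthogonal to everything induced from smaller
    levels.  The argument m is fuel: any m >= k gives the same function
    ([top_levelE]). *)
Fixpoint top_level n m k (u : 'S_k -> algC) : 'S_n -> algC :=
  if m is m'.+1 then
    fun g => ind_level n u g - \sum_(j < k) @top_level n m' j (res_level j u) g
  else ind_level n u.
Arguments top_level n m {k} u.

Lemma top_levelE n m k (u : 'S_k -> algC) : (k <= m)%N ->
  top_level n m u =1
    fun g => ind_level n u g - \sum_(j < k) top_level n m.-1 (res_level j u) g.
Proof. by case: m => [|m] //= + g; rewrite leqn0 => /eqP k0; subst k; rewrite big_ord0 subr0. Qed.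

(** The recursion removes from the Mackey formula all terms except i = j. *)
Lemma fdot_ind_top n m k j (u : 'S_k -> algC) (v : 'S_j -> algC) :
  (j <= m)%N -> (k + j <= n)%N ->
  fdot (ind_level n u) (top_level n m v) = fdot (res_level j u) (res_level j v).
Proof.
elim: m j v => [|m IHm] j v jm kjn.
  move: jm kjn; rewrite leqn0 => /eqP j0; subst j => /= kn.
  by rewrite fdot_ind_level // big_ord1.
rewrite (eq_fdot (frefl _) (top_levelE _ jm)) fdotBsumr fdot_ind_level //.
rewrite big_ord_recr /= addrAC -sumrB big1 ?add0r // => i _.
rewrite IHm; first last.
- by apply: leq_trans kjn; rewrite leq_add2l ltnW.
- by rewrite -ltnS (leq_trans _ jm).
apply/eqP; rewrite subr_eq0 eq_sym; apply/eqP/eq_fdot => // h.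
by rewrite res_level_id //; apply: res_level_class.
Qed.

Lemma fdot0l n (u v : 'S_n -> algC) : u =1 (fun=> 0) -> fdot u v = 0.
Proof.
by move=> u0; rewrite /fdot big1 ?mulr0 // => g _; rewrite u0 mul0r.
Qed.

Lemma fdot_top_orth n m m' j k (w : 'S_j -> algC) (u : 'S_k -> algC) :
  (j < k)%N -> (j <= m')%N -> (k <= m)%N -> (j + k <= n)%N ->
  fdot (top_level n m' w) (top_level n m u) = 0.
Proof.
elim: m' j w => [|m' IHm] j w jk jm km jkn.
  by rewrite fdot_ind_top // fdot0l //; apply: res_level_big.
rewrite (eq_fdot (top_levelE _ jm) (frefl _)) fdotBsuml fdot_ind_top //.
rewrite fdot0l ?sub0r; last exact: res_level_big.
rewrite big1 ?oppr0 // => i _; rewrite IHm //.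
- exact: ltn_trans jk.
- by rewrite -ltnS (leq_trans _ jm).
- by apply: leq_trans jkn; rewrite leq_add2r ltnW.
Qed.

(** Together with [fdot_top_orth], this makes [top_level] an isometry from
    class functions of all levels k with 2 k <= n to functions on S_n. *)
Lemma fdot_top_level n m k (u : 'S_k -> algC) :
  (k <= m)%N -> (k + k <= n)%N ->
  fdot (top_level n m u) (top_level n m u) = fdot (res_level k u) (res_level k u).
Proof.
move=> km kn.
rewrite (eq_fdot (top_levelE _ km) (frefl _)) fdotBsuml fdot_ind_top //.
rewrite big1 ?subr0 // => i _; apply: fdot_top_orth => //.
  by case: m km => [|m]; [rewrite leqn0 => /eqP k0; subst k; case: i|
     move=> km; rewrite -ltnS (leq_trans _ km)].
by apply: leq_trans kn; rewrite leq_add2r ltnW.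
Qed.

(** The corrections in [top_level] are invisible to a function orthogonal to all
    the lower levels. *)
Lemma fdot_top_primitive n d (chi : 'S_n -> algC) m k (u : 'S_k -> algC) :
  (forall j (v : 'S_j -> algC), (j < d)%N -> fdot (ind_level n v) chi = 0) ->
  (k <= m)%N -> (k <= d)%N ->
  fdot (top_level n m u) chi = fdot (ind_level n u) chi.
Proof.
move=> prim.
elim: m k u => [//|m IHm] k u km kd.
rewrite (eq_fdot (top_levelE _ km) (frefl _)) fdotBsuml.
rewrite big1 ?subr0 // => i _; rewrite /= IHm ?prim //.
- by rewrite (leq_trans _ kd).
- by rewrite -ltnS (leq_trans _ km).
- by rewrite (leq_trans _ kd) // ltnW.
Qed.

(** * Size of the top level part at permutations without short cycles *)

Definition fiber k n (a : {ffun 'I_k -> 'I_n}) (t : 'S_k) : {set 'S_n} :=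
  [set g : 'S_n | [forall i, g (a i) == a (t i)]].

Lemma fiberP k n (a : {ffun 'I_k -> 'I_n}) (t : 'S_k) (g : 'S_n) :
  reflect (forall i, g (a i) = a (t i)) (g \in fiber a t).
Proof.
by rewrite inE; apply: (iffP forallP) => H i; apply/eqP; rewrite H.
Qed.

Lemma fiber1 k n (a : {ffun 'I_k -> 'I_n}) (g : 'S_n) :
  (g \in fiber a 1) = perm_on (~: [set a i | i : 'I_k]) g.
Proof.
apply/fiberP/subsetP => [H x|H i].
  rewrite !inE; apply: contra => /imsetP[i _ ->]; by rewrite H perm1.
rewrite perm1; apply/eqP/negPn/negP => ga; have := H (a i) ga.
by rewrite !inE imset_f.
Qed.

(** Each fiber is a coset of the pointwise stabilizer of the image of a. *)
Lemma fiber_coset k n (a : {ffun 'I_k -> 'I_n}) (t : 'S_k) : injective a ->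
  exists g0 : 'S_n, forall h, ((h * g0)%g \in fiber a t) = (h \in fiber a 1).
Proof.
move=> aI; have [|g0 g0E] := @perm_transport _ _ a (fun i => a (t i)).
  by move=> i j; rewrite !(inj_eq aI) (inj_eq perm_inj).
exists g0 => h; apply/fiberP/fiberP => H i.
  by rewrite perm1; apply: (@perm_inj _ g0); rewrite -permM H g0E.
by rewrite permM H perm1 g0E.
Qed.

Lemma sum_fiber (V : nmodType) k n (a : {ffun 'I_k -> 'I_n}) (t : 'S_k) :
  injective a -> exists g0 : 'S_n, forall F : 'S_n -> V,
  \sum_(g in fiber a t) F g = \sum_(h in fiber a 1) F (h * g0)%g.
Proof.
move=> aI; have [g0 g0E] := fiber_coset t aI; exists g0 => F.
by rewrite (reindex_inj (mulIg g0)) /=; apply: eq_bigl => h; rewrite g0E.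
Qed.

Lemma card_fiber k n (a : {ffun 'I_k -> 'I_n}) (t : 'S_k) :
  injective a -> #|fiber a t| = (n - k)`!.
Proof.
move=> aI; rewrite -sum1_card.
have [g0 ->] := @sum_fiber nat k n a t aI; rewrite sum1_card.
rewrite (eq_card (fiber1 a)) card_perm cardsCs setCK card_imset //.
by rewrite !card_ord.
Qed.

Lemma sum_intertwiners (V : nmodType) k n (t : 'S_k) (F : 'S_n -> V) :
  \sum_g F g *+ #|intertwiners g t| =
  \sum_(a : {ffun 'I_k -> 'I_n} | injectiveb a) \sum_(g in fiber a t) F g.
Proof.
rewrite (exchange_big_dep predT) //=; apply: eq_bigr => g _.
rewrite sumr_const; congr (_ *+ _); apply: eq_card => a.
by rewrite inE [RHS]unfold_in /= inE.
Qed.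

Lemma sum_card_intertwiners k n (t : 'S_k) : (k <= n)%N ->
  (\sum_(g : 'S_n) #|intertwiners g t| = n`!)%N.
Proof.
move=> kn; transitivity (\sum_(g : 'S_n) 1%N *+ #|intertwiners g t|)%N.
  by apply: eq_bigr => g _; rewrite -[RHS]mulr_natl mulr1 natn.
rewrite sum_intertwiners.
transitivity (\sum_(a : {ffun 'I_k -> 'I_n} | injectiveb a) (n - k)`!)%N.
  apply: eq_bigr => a /injectiveP aI.
  by rewrite sum1_card card_fiber.
by rewrite sum_nat_const -cardsE card_inj_ffuns !card_ord ffact_fact.
Qed.

(** [res_level] is an average: the kernel has total mass k! by
    [sum_card_intertwiners]. *)
Lemma res_level_bound k j (u : 'S_k -> algC) (N : algC) h :
  (j <= k)%N -> (forall s, `|u s| <= N) -> `|res_level j u h| <= N.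
Proof.
move=> jk uN; rewrite /res_level normrM normfV normr_nat.
rewrite ler_pdivrMl ?ltr0n ?fact_gt0 //.
rewrite -(sum_card_intertwiners h jk) natr_sum big_distrl /=.
apply: le_trans (ler_norm_sum _ _ _) _; apply: ler_sum => s _.
by rewrite normrM normr_nat mulrC ler_wpM2l ?ler0n.
Qed.

(** C(f, e + 1) / C(f, e) = (f - e) / (e + 1) is at least 3 for e < d, because
    f >= 4 d. *)
Lemma binom_geometric f d j k : (4 * d <= f)%N -> (k <= d)%N -> (j <= k)%N ->
  (3 ^ (k - j) * 'C(f, j) <= 'C(f, k))%N.
Proof.
move=> df kd jk; have := kd; rewrite -{1 3}(subnKC jk); elim: (k - j)%N => [|i IHi].
  by rewrite addn0 mul1n.
rewrite addnS => lt_d; rewrite expnS -mulnA.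
apply: leq_trans (_ : 3 * 'C(f, j + i) <= _)%N.
  by rewrite leq_mul2l IHi // ltnW.
rewrite -(leq_pmul2l (ltn0Sn (j + i))) mul_bin_left mulnA leq_mul2r.
apply/orP; right; move: (j + i)%N lt_d => e lt_d.
lia.
Qed.

Lemma sum_pow3_pow2 k :
  \sum_(j < k) (3 ^+ j *+ 2 - 2 ^+ j) = 3 ^+ k - 2 ^+ k :> algC.
Proof.
elim: k => [|k IHk]; first by rewrite big_ord0 subrr.
by rewrite big_ord_recr /= IHk !exprS; ring.
Qed.

(** The recursion defining [top_level] is solved with majorants.  By induction
    the level j term is at most (2 - (2/3)^j) C(f, j) N, and C(f, j) is at most
    3^(j-k) C(f, k); these add up to (1 - (2/3)^k) C(f, k) N, by
    [sum_pow3_pow2].  The slack (2/3)^k is only exponentially small, which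
    the constant c of the theorem absorbs. *)
Lemma top_level_bound n f d (g : 'S_n) m k (u : 'S_k -> algC) (N : algC) :
  (forall j (v : 'S_j -> algC), (j <= d)%N ->
     ind_level n v g = 'C(f, j)%:R * v 1%g) ->
  (4 * d <= f)%N -> (k <= m)%N -> (k <= d)%N -> (forall s, `|u s| <= N) ->
  `|top_level n m u g - 'C(f, k)%:R * u 1%g| <=
    (1 - 2 ^+ k / 3 ^+ k) * ('C(f, k)%:R * N).
Proof.
move=> gE df; elim: m k u => [|m IHm] k u km kd uN.
  move: km; rewrite leqn0 => /eqP k0; subst k.
  by rewrite /= gE // subrr normr0 !expr0 divr1 subrr mul0r.
have N0 : 0 <= N by apply: le_trans (uN 1%g); rewrite normr_ge0.
rewrite top_levelE // gE // addrAC subrr add0r normrN.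
apply: le_trans (ler_norm_sum _ _ _) _.
have n30 i : 3 ^+ i != 0 :> algC by rewrite expf_neq0 // pnatr_eq0.
have -> : (1 - 2 ^+ k / 3 ^+ k) * ('C(f, k)%:R * N) =
    \sum_(j < k) (3 ^+ j *+ 2 - 2 ^+ j) * ('C(f, k)%:R * N / 3 ^+ k).
  by rewrite -big_distrl /= sum_pow3_pow2; field.
apply: ler_sum => j _.
have jk := ltnW (ltn_ord j); have jd := leq_trans jk kd.
have jm : (j <= m)%N by rewrite -ltnS (leq_trans (ltn_ord j)).
have vN := res_level_bound _ jk uN.
have tj := IHm j (res_level j u) jm jd (fun h => vN h).
have {tj} : `|top_level n m (res_level j u) g| <=
    (1 - 2 ^+ j / 3 ^+ j) * ('C(f, j)%:R * N) + 'C(f, j)%:R * N.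
  set x := _ * res_level j u 1%g in tj.
  rewrite -[X in `|X|](subrK x); apply: le_trans (ler_normD _ _) _.
  by apply: lerD => //; rewrite /x normrM normr_nat ler_wpM2l // ler0n.
move/le_trans; apply.
have -> : (1 - 2 ^+ j / 3 ^+ j) * ('C(f, j)%:R * N) + 'C(f, j)%:R * N =
   (3 ^+ j *+ 2 - 2 ^+ j) * ('C(f, j)%:R * N / 3 ^+ j).
  by field.
apply: ler_wpM2l.
  rewrite subr_ge0 -!natrX -mulrnA ler_nat.
  apply: (@leq_trans (3 ^ j)%N); last by rewrite leq_pmulr.
  by case: (nat_of_ord j) => // i; rewrite leq_exp2r.
rewrite mulrAC [leRHS]mulrAC; apply: ler_wpM2r => //.
rewrite ler_pdivrMr ?exprn_gt0 // mulrAC ler_pdivlMr ?exprn_gt0 //.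
have E : (3 ^ k = 3 ^ j * 3 ^ (k - j))%N by rewrite -expnD subnKC.
rewrite -!natrX -!natrM ler_nat E mulnCA [leqRHS]mulnC leq_mul2l mulnC.
by rewrite (binom_geometric df kd jk) orbT.
Qed.

(** * The permutation with one long cycle *)

(** If g a = a t, the image of a is a g-invariant set of j <= d points, so it
    meets no long cycle: a takes values in the fixed points and t = 1. *)
Lemma ind_level_sparse n d j (g : 'S_n) (v : 'S_j -> algC) :
  (forall x, g x != x -> (d < #|porbit g x|)%N) -> (j <= d)%N ->
  ind_level n v g = 'C(#|[set x | g x == x]|, j)%:R * v 1%g.
Proof.
move=> gE jd; set F := [set x | g x == x].
have fixa (s : 'S_j) a : a \in intertwiners g s -> forall i, g (a i) = a i.
  move=> /intertwinersP[aI aE] i; apply/eqP/negPn/negP => /gE.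
  rewrite ltnNge => /negP; apply; apply: leq_trans jd.
  apply: (@leq_trans #|codom a|); last by rewrite (card_codom aI) card_ord.
  apply/subset_leq_card.
  apply/subsetP=> _ /porbitP[k ->]; apply/codomP; exists ((s ^+ k)%g i).
  elim: k => [|k IHk]; first by rewrite !expg0 !perm1.
  by rewrite !expgSr !permM IHk aE.
rewrite /ind_level (bigD1 1%g) //= big1 ?addr0 => [|s s1].
  have -> : #|intertwiners g (1%g : 'S_j)| = (#|F| ^_ j)%N.
    transitivity #|[set a : {ffun 'I_j -> 'I_n} in ffun_on (mem F) | injectiveb a]|.
      apply: eq_card => a; rewrite [RHS]inE; apply/idP/andP => [aI|[aon aI]].
        split; last by case/intertwinersP: aI => /injectiveP.
        by apply/ffun_onP => i; rewrite inE (fixa _ _ aI).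
      apply/intertwinersP; split=> [|i]; first exact/injectiveP.
      by rewrite perm1; move/ffun_onP/(_ i): aon; rewrite inE => /eqP.
    by rewrite card_inj_ffuns_on card_ord.
  rewrite -bin_ffact natrM mulrCA [_ * j`!%:R]mulrC mulKf 1?mulrC //.
  by rewrite pnatr_eq0 -lt0n fact_gt0.
rewrite (_ : intertwiners g s = finset.set0) ?cards0 ?mulr0 //.
apply/setP=> a; rewrite in_set0; apply/negP => aI; case/eqP: s1.
apply/permP=> i; rewrite perm1; case/intertwinersP: (aI) => ainj aE.
by apply: ainj; rewrite -aE (fixa _ _ aI).
Qed.

Lemma exists_long_cycle f n : (f + 2 <= n)%N ->
  exists (g : 'S_n) (x0 : 'I_n),
  [/\ #|[set x | g x == x]| = f, #|porbit g x0| = (n - f)%N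
    & forall x, g x != x -> porbit g x = porbit g x0].
Proof.
move=> fn; pose s := [seq x : 'I_n <- enum 'I_n | (f <= x)%N].
have us : uniq s by rewrite filter_uniq ?enum_uniq.
have sE x : (x \in s) = (f <= x)%N by rewrite mem_filter mem_enum andbT.
have cfix : #|[set x : 'I_n | (x < f)%N]| = f.
  have fn' : (f <= n)%N by apply: leq_trans fn; apply: leq_addr.
  transitivity #|codom (widen_ord fn')|; last first.
    rewrite card_codom ?card_ord //.
    by move=> x y /(congr1 val)/= E; apply: val_inj.
  apply: eq_card => x; rewrite inE; apply/idP/codomP => [xf|[y ->]].
    by exists (Ordinal xf); apply: val_inj.
  exact: (ltn_ord y).
have ss : size s = (n - f)%N.
  have := cardsC [set x : 'I_n | (x < f)%N]; rewrite cfix card_ord => E.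
  rewrite -[X in (X - f)%N]E addKn -(card_uniqP us).
  by apply: eq_card => x; rewrite !inE sE -leqNgt.
have n0 : (n.-1 < n)%N by case: (n) fn => //; rewrite addn2.
pose x0 := Ordinal n0.
have x0s : x0 \in s by rewrite sE /=; lia.
have nI : injective (next s) by apply: can_inj (prev_next us).
pose g := perm nI.
have iterg k x : (g ^+ k)%g x = iter k (next s) x.
  by rewrite permX; apply: eq_iter => y; rewrite permE.
have orb x : x \in s -> porbit g x =i s.
  move=> xs y; rewrite -(fconnect_cycle (cycle_next us) xs).
  apply/porbitP/idP => [[k ->]|/iter_findex <-]; first by rewrite iterg fconnect_iter.
  by exists (findex (next s) x y); rewrite iterg.
exists g, x0; have gN x : x \notin s -> g x = x.
  by move=> xs; rewrite permE next_nth (negbTE xs).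
have gs x : x \in s -> g x != x.
  move=> xs; apply/eqP => gx.
  have /card_uniqP ssz := us.
  have : (#|porbit g x| <= 1)%N.
    rewrite -(cards1 x); apply/subset_leq_card/subsetP => _ /porbitP[k ->].
    rewrite inE; elim: k => [|k IHk]; first by rewrite expg0 perm1.
    by rewrite expgSr permM (eqP IHk) gx.
  by rewrite (eq_card (orb x xs)) ssz ss; lia.
split.
- rewrite -[RHS]cfix; apply: eq_card => x; rewrite !inE ltnNge -sE.
  by have [/gs/negbTE|/gN/eqP] := boolP (x \in s).
- by rewrite (eq_card (orb _ x0s)) (card_uniqP us).
- move=> x; have [xs _|/gN -> /eqP//] := boolP (x \in s).
  by apply/setP=> y; rewrite !orb.
Qed.

(** A permutation commuting with g preserves the fixed points of g, and on the
    long cycle it is determined by the image of one point.  Hence the centralizer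
    has at most f^f n elements. *)
Lemma card_class_long_cycle n (g : 'S_n) (x0 : 'I_n) :
  (forall x, g x != x -> porbit g x = porbit g x0) ->
  (n`! <= #|(g ^: [set: 'S_n])%g| *
    (#|[set x | g x == x]| ^ #|[set x | g x == x]| * n))%N.
Proof.
move=> gE; set F := [set x | _].
have -> : n`! = (#|(g ^: [set: 'S_n])%g| * #|('C[g])%g|)%N.
  rewrite -index_cent1 setTI mulnC Lagrange ?subsetT //.
  by rewrite cardsT card_Sn.
rewrite leq_mul2l; apply/orP; right.
pose phi (y : 'S_n) : {ffun {x | x \in F} -> {x | x \in F}} * 'I_n :=
  ([ffun u => insubd u (y (val u))], y x0).
have phiI : {in ('C[g])%g &, injective phi}.
  move=> y z /cent1P yg /cent1P zg [] /ffunP E1 E2.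
  have fixE (w : 'S_n) u : commute w g -> u \in F -> w u \in F.
    by rewrite !inE => wg /eqP gu; rewrite -permM wg permM gu.
  apply/permP=> x; have [xF|] := boolP (x \in F).
    have := E1 (exist _ x xF); rewrite !ffunE => /(congr1 val).
    by rewrite !val_insubd /= !fixE.
  rewrite inE => /gE xo; have : x \in porbit g x0 by rewrite -xo porbit_id.
  case/porbitP=> k ->; rewrite -!permM.
  have c w : commute w g -> (g ^+ k * w = w * g ^+ k)%g.
    by move=> wg; rewrite (commuteX k wg).
  by rewrite !c // !permM E2.
rewrite -(card_in_imset phiI); apply: leq_trans (max_card _) _.
by rewrite card_prod card_ffun card_sig !card_ord.
Qed.

(** * Characters with fixed vectors under a large symmetric group *)

Lemma mxtrace_idempotent (F : fieldType) m (E : 'M[F]_m) :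
  E *m E = E -> \tr E = (\rank E)%:R.
Proof.
move=> EE; rewrite -{1}(mulmx_base E) mxtrace_mulC.
suff -> : row_base E *m col_base E = 1%:M by rewrite mxtrace1.
apply: (row_full_inj (col_base_full E)); rewrite mulmx1.
apply: (row_free_inj (row_base_free E)).
by rewrite -mulmxA -mulmxA mulmxA !mulmx_base EE.
Qed.

(** A multiple of the projector onto the vectors fixed by Sym(Y). *)
Definition perm_on_sum n m (rG : mx_representation algC [set: 'S_n] m)
  (Y : {set 'I_n}) : 'M[algC]_m := \sum_(h | perm_on Y h) rG h.

Lemma perm_on_sum_fixed n m (rG : mx_representation algC [set: 'S_n] m) Y h :
  perm_on Y h -> rG h *m perm_on_sum rG Y = perm_on_sum rG Y.
Proof.
move=> Yh; rewrite /perm_on_sum mulmx_sumr [RHS](reindex_inj (mulgI h)) /=.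
apply: eq_big => [g|g _]; last by rewrite repr_mxM ?inE.
apply/idP/idP => Yg; first exact: perm_onM.
by rewrite -[g](mulKg h); apply: perm_onM => //; apply: perm_onV.
Qed.

(** The trace is a positive multiple of the dimension of the fixed space. *)
Lemma mxtrace_perm_on_sum n m (rG : mx_representation algC [set: 'S_n] m) Y :
  0 <= \tr (perm_on_sum rG Y) ?= iff (perm_on_sum rG Y == 0).
Proof.
set T := perm_on_sum rG Y; pose c : algC := #|perm_on Y|%:R.
have c0 : 0 < c by rewrite ltr0n card_perm fact_gt0.
have cN0 : c != 0 by rewrite gt_eqF.
have TT : T *m T = c *: T.
  rewrite {1}/T /perm_on_sum mulmx_suml.
  rewrite (eq_bigr (fun=> T)) => [|h Yh]; last exact: perm_on_sum_fixed.
  by rewrite sumr_const -scaler_nat.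
have EE : (c^-1 *: T) *m (c^-1 *: T) = c^-1 *: T.
  by rewrite -scalemxAl -scalemxAr TT !scalerA -?mulrA mulVf ?mulr1.
have trT : \tr T = c * (\rank (c^-1 *: T))%:R.
  by rewrite -(mxtrace_idempotent EE) mxtraceZ mulVKf.
rewrite trT; split; first by rewrite mulr_ge0 ?ler0n // ltW.
rewrite eq_sym mulf_eq0 (negbTE cN0) pnatr_eq0 mxrank_eq0 scaler_eq0.
by rewrite invr_eq0 (negbTE cN0).
Qed.

Lemma fdotE n (u v : 'CF([set: 'S_n])) : fdot u v = '[u, v].
Proof.
by rewrite cfdotE cardsT card_Sn; congr (_ * _); apply: eq_bigl => g; rewrite inE.
Qed.

Lemma fdot_sub_scale n (u v : 'S_n -> algC) (c : nat) :
  fdot (fun g => u g - c%:R * v g) (fun g => u g - c%:R * v g) =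
  fdot u u - c%:R * (fdot u v + fdot v u) + c%:R ^+ 2 * fdot v v.
Proof.
rewrite /fdot -mulrDr !mulrA ![_ * _^-1]mulrC -!mulrA -mulrBr -mulrDr.
congr (_ * _); rewrite -big_split !big_distrr /= -sumrB -big_split.
apply: eq_bigr => g _ /=; rewrite rmorphB rmorphM rmorph_nat /=; ring.
Qed.

(** The squared norm of u - c v is 1 - c^2, so a nonzero natural number c must
    be 1. *)
Lemma unit_vector_eq n (u v : 'S_n -> algC) (c : nat) :
  fdot u u = 1 -> fdot v v = 1 -> fdot u v = c%:R -> c != 0%N -> u =1 v.
Proof.
move=> u1 v1 uv c0.
have vu : fdot v u = c%:R by rewrite fdotC uv rmorph_nat.
have H (w : 'S_n -> algC) : 0 <= fdot w w /\ (fdot w w = 0 -> w =1 (fun=> 0 : algC)).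
  have pos g : 0 <= w g * (w g)^* by rewrite mul_conjC_ge0.
  rewrite /fdot; split.
    by rewrite mulr_ge0 ?invr_ge0 ?ler0n // sumr_ge0.
  move/eqP; rewrite mulf_eq0 invr_eq0 pnatr_eq0 gtn_eqF ?fact_gt0 //=.
  rewrite psumr_eq0 // => /allP E g.
  by have := E g; rewrite mem_index_enum mul_conjC_eq0 => /(_ isT)/eqP.
have [pos zero] := H (fun g => u g - c%:R * v g).
have E : fdot (fun g => u g - c%:R * v g) (fun g => u g - c%:R * v g) =
    1 - c%:R ^+ 2.
  by rewrite fdot_sub_scale u1 v1 uv vu; ring.
have c1 : c = 1%N.
  apply/eqP; rewrite eqn_leq lt0n c0 andbT.
  by move: pos; rewrite E subr_ge0 -natrX lern1; case: (c) => [|[]].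
move: zero; rewrite E c1 expr1n subrr => /(_ erefl) z g.
by apply/eqP; rewrite -subr_eq0; have := z g; rewrite mul1r => ->.
Qed.

Section PrimitiveCharacter.
Variables (n m : nat) (rG : mx_representation algC [set: 'S_n] m).
Local Notation chi := (cfRepr rG).

Lemma fdot_ind_level_fiber k (v : 'S_k -> algC) (u : 'S_n -> algC) :
  fdot (ind_level n v) u = (n`!%:R)^-1 * (k`!%:R)^-1 *
    \sum_(a : {ffun 'I_k -> 'I_n} | injectiveb a)
      \sum_s \sum_(g in fiber a s) v s * (u g)^*.
Proof.
rewrite /fdot -mulrA; congr (_ * _).
rewrite exchange_big big_distrr /= [LHS](eq_bigr (fun g => (k`!%:R)^-1 *
   \sum_s v s * (u g)^* *+ #|intertwiners g s|)); last first.
  move=> g _; rewrite /ind_level -mulrA big_distrl; congr (_ * _).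
  by apply: eq_bigr => s _; rewrite -[RHS]mulr_natr /= mulrAC.
rewrite -big_distrr /= exchange_big big_distrr /=; apply: eq_bigr => s _.
by rewrite sum_intertwiners.
Qed.

Lemma sum_fiber1_chi k (a : {ffun 'I_k -> 'I_n}) (B : 'M[algC]_m) :
  \sum_(h in fiber a 1) \tr (rG h *m B) =
  \tr (perm_on_sum rG (~: [set a i | i : 'I_k]) *m B).
Proof.
rewrite /perm_on_sum mulmx_suml raddf_sum; apply: eq_bigl => h.
by rewrite fiber1.
Qed.

(** In the inner product, the sum over each fiber factors through the projector
    onto the vectors fixed by Sym(Y), with Y the complement of the image of an
    injection of k letters. *)
Lemma primitive_orthogonal d k (v : 'S_k -> algC) : (d <= n)%N ->
  (forall Y : {set 'I_n}, (n - d < #|Y|)%N -> perm_on_sum rG Y = 0) ->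
  (k < d)%N -> fdot (ind_level n v) chi = 0.
Proof.
move=> dn prim kd; rewrite fdot_ind_level_fiber big1 ?mulr0 // => a.
move/injectiveP => aI; rewrite big1 // => s _; rewrite -big_distrr /=.
have [g0 ->] := @sum_fiber algC k n a s aI.
rewrite -rmorph_sum /= (eq_bigr (fun h => \tr (rG h *m rG g0))); last first.
  by move=> h _; rewrite cfunE inE repr_mxM ?inE.
rewrite sum_fiber1_chi prim ?mul0mx ?mxtrace0 ?conjC0 ?mulr0 //.
rewrite cardsCs setCK card_imset // !card_ord.
by apply: ltn_sub2l => //; apply: leq_trans dn.
Qed.

(** Weighting the irreducible characters of S_d by their degrees gives the
    regular character, which turns the inner product into a sum of multiples of
    the traces of the projectors for the Y with n - d letters.  These are nonnegative and one
    of them is positive. *)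
Lemma primitive_exists_irr d (Y : {set 'I_n}) : (d <= n)%N ->
  #|Y| = (n - d)%N -> perm_on_sum rG Y != 0 ->
  exists i : Iirr [set: 'S_d], fdot (ind_level n 'chi_i) chi != 0.
Proof.
move=> dn cY TY; apply/existsP; apply: contraT; rewrite negb_exists => /forallP H.
have {H} : \sum_(i : Iirr [set: 'S_d]) ('chi_i 1%g) * fdot (ind_level n 'chi_i) chi = 0.
  by apply: big1 => i _; have := H i; rewrite negbK => /eqP ->; rewrite mulr0.
under eq_bigr => i _ do rewrite fdot_ind_level_fiber mulrCA.
rewrite -big_distrr /=; under eq_bigr => i _ do rewrite big_distrr.
rewrite exchange_big /= => /eqP; rewrite !mulf_eq0 !invr_eq0 !pnatr_eq0.
rewrite !gtn_eqF ?fact_gt0 //= => /eqP.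
have regE (s : 'S_d) : \sum_(i : Iirr [set: 'S_d]) 'chi_i 1%g * 'chi_i s =
    d`!%:R *+ (s == 1%g).
  rewrite -card_Sn -cardsT -cfRegE cfReg_sum sum_cfunE.
  by apply: eq_bigr => i _; rewrite cfunE.
have fibE (a : {ffun 'I_d -> 'I_n}) :
    \sum_(i : Iirr [set: 'S_d])
     'chi_i 1%g * (\sum_s \sum_(g in fiber a s) 'chi_i s * (chi g)^*) =
    d`!%:R * (\tr (perm_on_sum rG (~: [set a i | i : 'I_d])))^*.
  transitivity (\sum_s (\sum_(i : Iirr [set: 'S_d]) 'chi_i 1%g * 'chi_i s) *
                \sum_(g in fiber a s) (chi g)^*).
    under eq_bigr => i _ do rewrite big_distrr.
    rewrite exchange_big /=; apply: eq_bigr => s _.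
    rewrite big_distrl; apply: eq_bigr => i _ /=.
    by rewrite -big_distrr mulrA.
  rewrite (bigD1 1%g) //= [X in _ + X]big1 ?addr0 => [|s /negbTE s1].
    rewrite regE eqxx; congr (_ * _); rewrite -rmorph_sum /=; congr (_^*).
    rewrite -[perm_on_sum _ _]mulmx1 -sum_fiber1_chi; apply: eq_bigr => g _.
    by rewrite cfunE inE mulmx1.
  by rewrite regE s1 mul0r.
rewrite (eq_bigr _ (fun a _ => fibE a)) -big_distrr -rmorph_sum /= => /eqP.
rewrite mulf_eq0 pnatr_eq0 gtn_eqF ?fact_gt0 //= conjC_eq0.
have [a [aI aY]] : exists a : {ffun 'I_d -> 'I_n},
   injective a /\ ~: [set a i | i : 'I_d] = Y.
  have cYC : #|~: Y| = d by rewrite cardsCs setCK cY card_ord subKn.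
  exists [ffun i => enum_val (cast_ord (esym cYC) i)]; split=> [i i'|].
    by rewrite !ffunE => /enum_val_inj/cast_ord_inj.
  apply: setC_inj; rewrite setCK; apply/eqP; rewrite eqEcard; apply/andP; split.
    by apply/subsetP=> _ /imsetP[i _ ->]; rewrite ffunE; apply: enum_valP.
  rewrite card_imset; first by rewrite cYC card_ord.
  by move=> i i'; rewrite !ffunE => /enum_val_inj/cast_ord_inj.
rewrite psumr_eq0 => [|a' _]; last by have [] := mxtrace_perm_on_sum rG (~: [set a' i | i : 'I_d]).
move/allP/(_ a); rewrite mem_index_enum => /(_ isT).
have [_] := mxtrace_perm_on_sum rG Y.
by rewrite eq_sym aY (negbTE TY) => ->; rewrite implybF => /injectiveP.
Qed.

(** By Frobenius reciprocity: the inner product is computed on the stabilizer K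
    of the first d letters, between the restriction of chi and the inflation of
    'chi_i along the action f of K on these letters. *)
Lemma primitive_fdot_nat d (i : Iirr [set: 'S_d]) : (d <= n)%N ->
  fdot (ind_level n 'chi_i) chi \in Num.nat.
Proof.
move=> dn; pose a0 : {ffun 'I_d -> 'I_n} := [ffun i => widen_ord dn i].
have a0I : injective a0.
  by move=> j j'; rewrite !ffunE => /(congr1 val) E; apply: val_inj.
pose K := [set g : 'S_n | [exists s : 'S_d, g \in fiber a0 s]].
pose f (g : 'S_n) : 'S_d := odflt 1%g [pick s : 'S_d | g \in fiber a0 s].
have fibU g s s' : g \in fiber a0 s -> g \in fiber a0 s' -> s = s'.
  by move=> /fiberP gs /fiberP gs'; apply/permP=> j; apply: a0I; rewrite -gs gs'.
have fE g s : g \in fiber a0 s -> f g = s.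
  move=> gs; rewrite /f; case: pickP => [s' gs' /=|/(_ s)]; last by rewrite gs.
  exact: fibU gs' gs.
have fibM g h s t : g \in fiber a0 s -> h \in fiber a0 t ->
    (g * h)%g \in fiber a0 (s * t)%g.
  by move=> /fiberP gs /fiberP ht; apply/fiberP=> j; rewrite !permM gs ht.
have KP g : reflect (exists s, g \in fiber a0 s) (g \in K).
  by rewrite inE; apply: existsP.
have Kg : group_set K.
  apply/group_setP; split=> [|g h /KP[s gs] /KP[t ht]].
    by apply/KP; exists 1%g; apply/fiberP => j; rewrite !perm1.
  by apply/KP; exists (s * t)%g; apply: fibM.
have fM : {in group Kg &, {morph f : g h / (g * h)%g}}.
  move=> g h /KP[s gs] /KP[t ht].
  by rewrite (fE _ _ gs) (fE _ _ ht) (fE _ _ (fibM _ _ _ _ gs ht)).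
pose fm := Morphism fM.
have KfE (s : 'S_d) g : (g \in K) && (f g == s) = (g \in fiber a0 s).
  apply/andP/idP => [[/KP[t gt]] /eqP <-|gs].
    by rewrite (fE _ _ gt).
  by split; [apply/KP; exists s|apply/eqP/fE].
have cK : #|K| = (d`! * (n - d)`!)%N.
  rewrite -sum1_card (partition_big f predT) //= -{1}card_Sn -sum_nat_const.
  apply: eq_bigr => s _; rewrite (eq_bigl _ _ (KfE s)) sum1_card.
  exact: card_fiber.
pose S (a : {ffun 'I_d -> 'I_n}) :=
  \sum_s \sum_(g in fiber a s) 'chi_i s * (chi g)^*.
(* Every injection is a translate of a0, and chi is a class function. *)
have SE (a : {ffun 'I_d -> 'I_n}) : injective a -> S a = S a0.
  move=> aI; have [|y yE] := @perm_transport _ _ a0 a.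
    by move=> j j'; rewrite (inj_eq a0I) (inj_eq aI).
  apply: eq_bigr => s _; rewrite [RHS](reindex_inj (conjg_inj y^-1%g)) /=.
  apply: eq_big => [g|g _]; last by rewrite cfunJ ?inE.
  apply/fiberP/fiberP => H j; have := H j; rewrite conjgE invgK !permM yE.
    by move=> ->; rewrite -yE permK.
  by rewrite -yE => E; rewrite -[LHS](permKV y) -yE E yE.
pose phi : 'CF(group Kg) :=
  @cfMorph _ _ (group Kg) fm (group Kg) ('Res[(fm @* group Kg)%G] 'chi_i).
have phiE g : g \in K -> phi g = 'chi_i (f g).
  move=> gK; rewrite [LHS](@cfMorphE _ _ (group Kg) fm (group Kg)) //.
  by rewrite cfResE ?subsetT // (@mem_morphim _ _ (group Kg) fm).
have -> : fdot (ind_level n 'chi_i) chi = '[phi, 'Res[group Kg] chi].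
  rewrite fdot_ind_level_fiber (eq_bigr (fun=> S a0)); last first.
    by move=> a /injectiveP; apply: SE.
  rewrite sumr_const -[S a0 *+ _]mulr_natl.
  rewrite cfdotE /= cK.
  have -> : \sum_(x in K) phi x * ('Res[group Kg] chi x)^* = S a0.
    rewrite (partition_big f predT) //=; apply: eq_bigr => s _.
    apply: eq_big => [g|g /andP[gK /eqP fg]]; first exact: KfE.
    by rewrite phiE // cfResE ?subsetT // fg.
  rewrite mulrA; congr (_ * _).
  rewrite -cardsE card_inj_ffuns !card_ord.
  rewrite -(ffact_fact dn) !natrM !invfM.
  have F k : k`!%:R != 0 :> algC by rewrite pnatr_eq0 gtn_eqF ?fact_gt0.
  have F2 : (n ^_ d)%:R != 0 :> algC.
    by rewrite pnatr_eq0 -lt0n ffact_gt0.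
  by field; rewrite !F F2.
by rewrite Cnat_cfdot_char ?cfMorph_char ?cfRes_char ?irr_char ?cfRepr_char.
Qed.


Lemma primitive_top_level d : (d + d <= n)%N -> '[chi] = 1 ->
  (forall Y : {set 'I_n}, (n - d < #|Y|)%N -> perm_on_sum rG Y = 0) ->
  (exists2 Y : {set 'I_n}, #|Y| = (n - d)%N & perm_on_sum rG Y != 0) ->
  exists i : Iirr [set: 'S_d], top_level n d 'chi_i =1 chi.
Proof.
move=> ddn chi1 prim [Y cY TY]; have dn : (d <= n)%N by apply: leq_trans ddn; apply: leq_addr.
have [i ci] := primitive_exists_irr dn cY TY; exists i.
have [c cE] := natrP (primitive_fdot_nat i dn).
have prim' j (v : 'S_j -> algC) : (j < d)%N -> fdot (ind_level n v) chi = 0.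
  exact: primitive_orthogonal.
have XX : fdot (top_level n d 'chi_i) (top_level n d 'chi_i) = 1.
  rewrite fdot_top_level //.
  have E : res_level d 'chi_i =1 'chi_i.
    by apply: res_level_id => g h; rewrite cfunJ ?inE.
  by rewrite (eq_fdot E E) fdotE cfnorm_irr.
have Xc := fdot_top_primitive 'chi_i prim' (leqnn d) (leqnn d).
apply: (@unit_vector_eq _ _ _ c) => //; first by rewrite fdotE.
  by rewrite Xc cE.
by apply: contraNneq ci => c0; rewrite cE c0.
Qed.
End PrimitiveCharacter.

(** * Specht modules *)

(** The boolean b selects the trivial or the sign character, so that the cases
    of a long first row and of a long first column are treated together. *)
Definition sgn_if n (b : bool) (g : 'S_n) : algC := (-1) ^+ (b && odd_perm g).

Lemma sgn_ifM n b (g h : 'S_n) : sgn_if b (g * h) = sgn_if b g * sgn_if b h.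
Proof. by case: b; rewrite /sgn_if ?odd_permM ?signr_addb ?mulr1. Qed.

Lemma sgn_if1 n b : sgn_if b (1 : 'S_n) = 1.
Proof. by rewrite /sgn_if odd_perm1 andbF. Qed.

Lemma sgn_if_sqr n b (g : 'S_n) : sgn_if b g * sgn_if b g = 1.
Proof. by rewrite /sgn_if -expr2 sqrr_sign. Qed.

Definition twist_mx n m b (rG : mx_representation algC [set: 'S_n] m) (g : 'S_n) :=
  sgn_if b g *: rG g.

Lemma twist_mx_repr n m b (rG : mx_representation algC [set: 'S_n] m) :
  mx_repr [set: 'S_n] (twist_mx b rG).
Proof.
split=> [|g h _ _]; first by rewrite /twist_mx sgn_if1 scale1r repr_mx1.
by rewrite /twist_mx sgn_ifM repr_mxM ?inE // -scalemxAl -scalemxAr scalerA.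
Qed.
Definition twist_repr n m b rG := MxRepresentation (@twist_mx_repr n m b rG).

Lemma cfRepr_twist n m b (rG : mx_representation algC [set: 'S_n] m) g :
  cfRepr (twist_repr b rG) g = sgn_if b g * cfRepr rG g.
Proof. by rewrite !cfunE inE mxtraceZ. Qed.

Lemma cfnorm_twist n m b (rG : mx_representation algC [set: 'S_n] m) :
  '[cfRepr (twist_repr b rG)] = '[cfRepr rG].
Proof.
rewrite -!fdotE /fdot; congr (_ * _); apply: eq_bigr => g _.
rewrite !cfRepr_twist rmorphM /= {2}/sgn_if rmorph_sign -/(sgn_if b g).
by rewrite mulrACA sgn_if_sqr mul1r.
Qed.

Section Specht.
Variable n : nat.
Local Notation aG := (regular_repr algC [set: 'S_n]).
Local Notation nG := #|[set: 'S_n]%G|.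

Definition basis_vector (x : 'S_n) : 'rV[algC]_nG :=
  delta_mx 0 (gring_index [set: 'S_n]%G x).

Lemma basis_vectorM x g : basis_vector x *m aG g = basis_vector (x * g)%g.
Proof. by rewrite -rowE rowK gring_indexK ?inE. Qed.

Lemma regular_trmx g : (aG g)^T = aG g^-1%g.
Proof.
have vI := can_inj (@gring_valK _ [set: 'S_n]%G).
apply/matrixP=> i j; rewrite !mxE !eqxx /=; congr (_%:R).
rewrite -!(inj_eq vI) !gring_indexK ?inE //.
by rewrite eq_sym -[in RHS](inj_eq (mulIg g)) mulgKV eq_sym.
Qed.

(** The function w is the row or the column index of a cell; its stabilizer is
    then the row or the column stabilizer of the tableau. *)
Definition stabilizes (w : 'I_n -> nat) (s : 'S_n) := [forall k, w (s k) == w k].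

Lemma stabilizesP w (s : 'S_n) :
  reflect (forall k, w (s k) = w k) (stabilizes w s).
Proof. by apply: (iffP forallP) => H k; apply/eqP. Qed.

Definition stab_sum b (w : 'I_n -> nat) : 'M[algC]_nG :=
  \sum_(s | stabilizes w s) sgn_if b s *: aG s.

Lemma stabilizesM w s t : stabilizes w s -> stabilizes w (s * t)%g = stabilizes w t.
Proof.
move/stabilizesP=> ws; apply/stabilizesP/stabilizesP => H k.
  by have := H (s^-1%g k); rewrite permM permKV => ->; rewrite -ws permKV.
by rewrite permM H.
Qed.

Lemma stabilizesV w s : stabilizes w s^-1%g = stabilizes w s.
Proof.
apply/stabilizesP/stabilizesP => H k.
  by rewrite -(H (s k)) permK.
by rewrite -(H (s^-1%g k)) permKV.
Qed.

Lemma stab_sumMl b w s : stabilizes w s ->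
  aG s *m stab_sum b w = sgn_if b s *: stab_sum b w.
Proof.
move=> ws; rewrite /stab_sum mulmx_sumr scaler_sumr [RHS](reindex_inj (mulgI s)) /=.
apply: eq_big => [t|t _]; first by rewrite stabilizesM.
by rewrite -scalemxAr -repr_mxM ?inE // scalerA sgn_ifM mulrA sgn_if_sqr mul1r.
Qed.

Lemma stab_sum_trmx b w : (stab_sum b w)^T = stab_sum b w.
Proof.
rewrite /stab_sum raddf_sum (reindex_inj invg_inj) /=.
apply: eq_big => [t|t _]; first exact: stabilizesV.
by rewrite linearZ /= regular_trmx invgK /sgn_if odd_permV.
Qed.

Lemma stab_sumMr b w s : stabilizes w s ->
  stab_sum b w *m aG s = sgn_if b s *: stab_sum b w.
Proof.
move=> ws; apply: trmx_inj; rewrite trmx_mul stab_sum_trmx regular_trmx.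
rewrite stab_sumMl ?stabilizesV // linearZ /= stab_sum_trmx.
by rewrite /sgn_if odd_permV.
Qed.

Definition regular_perm_on_sum b (Y : {set 'I_n}) : 'M[algC]_nG :=
  \sum_(h | perm_on Y h) sgn_if b h *: aG h.

Lemma regular_perm_on_sumE b Y :
  regular_perm_on_sum b Y = perm_on_sum (twist_repr b aG) Y.
Proof. by []. Qed.

(** Two points of Y have the same w-value after x^-1.  The transposition of
    these points is absorbed by both outer factors, with opposite signs, so the
    product equals its own opposite. *)
Lemma stab_sum_pigeonhole b (w : 'I_n -> nat) L (Y : {set 'I_n}) x :
  (forall k, w k < L)%N -> (L < #|Y|)%N ->
  stab_sum (~~ b) w *m aG x *m regular_perm_on_sum b Y = 0.
Proof.
move=> wL LY.
have [u uY [v vY [uv wuv]]] : exists2 u, u \in Y & exists2 v, v \in Y &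
    u != v /\ w (x^-1%g u) = w (x^-1%g v).
  pose f u := Ordinal (wL (x^-1%g u)).
  have /dinjectivePn[u uY [v vY fuv]] : ~~ dinjectiveb f (mem Y).
    apply: contraL LY => /dinjectiveP fI; rewrite -leqNgt.
    by rewrite -(card_in_imset fI) -[leqRHS]card_ord max_card.
  move: vY; rewrite !inE => /andP[vu vY]; exists u => //; exists v => //.
  by split; [rewrite eq_sym | have := congr1 val fuv].
set T := regular_perm_on_sum b Y; pose t := tperm u v.
have Yt : perm_on Y t.
  by apply/subsetP=> k; rewrite !inE /t; case: tpermP => [->|->|_ _] //; rewrite eqxx.
have tT : aG t *m T = sgn_if b t *: T.
  rewrite /T regular_perm_on_sumE -{2}(perm_on_sum_fixed (twist_repr b aG) Yt).
  by rewrite /= /twist_mx -scalemxAl scalerA sgn_if_sqr scale1r.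
have st : stabilizes w (t ^ x^-1)%g.
  apply/stabilizesP => k; rewrite /t tpermJ.
  by case: tpermP => [->|->|//].
have sx : (x * t = (t ^ x^-1) * x)%g by rewrite conjgE invgK -!mulgA mulVg mulg1.
set X := _ *m T.
have : X = - X.
  rewrite {1}/X -[T]scale1r -(sgn_if_sqr b t) -scalerA -tT -scalemxAr.
  rewrite mulmxA -[_ *m aG x *m aG t]mulmxA -repr_mxM ?inE // sx.
  rewrite repr_mxM ?inE // mulmxA stab_sumMr // -!scalemxAl scalerA -/X.
  rewrite -[RHS]scaleN1r; congr (_ *: _).
  rewrite /sgn_if odd_permJ /t odd_tperm uv.
  by case: (b); rewrite /= ?mulr1 ?mul1r.
move/eqP; rewrite -addr_eq0 -mulr2n -scaler_nat scaler_eq0 pnatr_eq0 /=.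
by move/eqP.
Qed.

Lemma young_symmetrizerE la :
  young_symmetrizer n la = basis_vector 1 *m
   stab_sum false (fun k => reshape_index la k) *m
   stab_sum true (fun k => reshape_offset la k).
Proof.
rewrite /young_symmetrizer /stab_sum [basis_vector 1 *m _]mulmx_sumr mulmx_suml.
apply: eq_big => [p|p _]; first by rewrite inE.
rewrite mulmx_sumr; apply: eq_big => [q|q _]; first by rewrite inE.
rewrite /sgn_if /= scale1r basis_vectorM -scalemxAr basis_vectorM.
by rewrite mul1g.
Qed.

Lemma submod_sum_eq0 m (rG : mx_representation algC [set: 'S_n] m)
   (U : 'M_m) (Umod : mxmodule rG U) b Y :
  (perm_on_sum (twist_repr b (submod_repr Umod)) Y == 0) =
  (U *m perm_on_sum (twist_repr b rG) Y == 0).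
Proof.
set T := perm_on_sum (twist_repr b rG) Y.
have -> : perm_on_sum (twist_repr b (submod_repr Umod)) Y =
    in_submod U (val_submod 1%:M *m T).
  rewrite /T /perm_on_sum mulmx_sumr linear_sum; apply: eq_bigr => h _ /=.
  by rewrite /twist_mx -scalemxAr linearZ.
have sub : (val_submod (1%:M : 'M_(\rank U)) *m T <= U)%MS.
  rewrite /T /perm_on_sum mulmx_sumr; apply: summx_sub => h _.
  rewrite -scalemxAr scalemx_sub //; apply: mxmodule_trans; rewrite ?inE //.
  exact: val_submodP.
rewrite -(val_submod_eq0 (in_submod U _)) in_submodK // -!sub_kermx.
by rewrite /val_submod /= mul1mx eq_row_base.
Qed.

(** L bounds the number of columns (of rows, in the sign case).  The pigeonhole
    applies to the column sum, which is the right factor of the symmetrizer; in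
    the sign case it applies to the row sum, after expanding the column sum. *)
Lemma young_module_sum0 la b L (Y : {set 'I_n}) :
  (forall k : 'I_n, (if b then reshape_index la k else reshape_offset la k) < L)%N ->
  (L < #|Y|)%N ->
  perm_on_sum (twist_repr b (specht_repr n la)) Y = 0.
Proof.
move=> wL LY; apply/eqP; rewrite /specht_repr submod_sum_eq0 -regular_perm_on_sumE.
rewrite -sub_kermx genmxE; apply/row_subP=> i; rewrite sub_kermx.
rewrite row_mul mul_rV_lin1 /= rowK mxvecK young_symmetrizerE -!mulmxA.
set x := enum_val i; apply/eqP; case: b wL => wL; last first.
  by rewrite [stab_sum true _ *m _]mulmxA (@stab_sum_pigeonhole false _ L) ?mulmx0.
have pig q := @stab_sum_pigeonhole true _ L Y (q * x) wL LY.
move: pig; move: (stab_sum (~~ true) _) (regular_perm_on_sum _ _) => A T pig.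
rewrite /stab_sum mulmx_suml !mulmx_sumr; apply: big1 => q _.
rewrite -scalemxAl -!scalemxAr [aG q *m _]mulmxA -repr_mxM ?inE //.
by rewrite [A *m _]mulmxA pig mulmx0 scaler0.
Qed.

Lemma perm_on_stabilizes (w : 'I_n -> nat) (Y : {set 'I_n}) h :
  {in Y &, forall k l, w k = w l} -> perm_on Y h -> stabilizes w h.
Proof.
move=> wY Yh; apply/stabilizesP => k; have [kY|kY] := boolP (k \in Y).
  by apply: wY; rewrite ?(perm_closed _ Yh).
by rewrite (out_perm Yh).
Qed.

Lemma fixed_vector_sum b w (Y : {set 'I_n}) m (v : 'M[algC]_(m, nG)) :
  {in Y &, forall k l, w k = w l} -> v *m stab_sum b w != 0 ->
  v *m stab_sum b w *m regular_perm_on_sum b Y != 0.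
Proof.
move=> wY vC; rewrite /regular_perm_on_sum mulmx_sumr.
rewrite (eq_bigr (fun=> v *m stab_sum b w)) => [|h Yh]; last first.
  rewrite -scalemxAr -mulmxA stab_sumMr ?(perm_on_stabilizes wY Yh) //.
  by rewrite -scalemxAr scalerA sgn_if_sqr scale1r.
by rewrite sumr_const -scaler_nat scaler_eq0 pnatr_eq0 (negbTE vC) orbF
  card_perm -lt0n fact_gt0.
Qed.

Lemma young_symmetrizer_int la k : young_symmetrizer n la 0 k \in Num.int.
Proof.
rewrite /young_symmetrizer summxE rpred_sum // => p _.
rewrite summxE rpred_sum // => q _; rewrite !mxE rpredM ?rpredX ?rpredN ?rpred1 //.
exact: rpred_nat.
Qed.

(** With e = delta_1 A B for the row sum A and the signed column sum B, both
    symmetric matrices, the coefficient at 1 of e B A is the sum of the squares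
    of the coefficients of e, which are integers. *)
Lemma young_symmetrizer_sandwich la : young_symmetrizer n la != 0 ->
  young_symmetrizer n la *m stab_sum true (fun k => reshape_offset la k)
    *m stab_sum false (fun k => reshape_index la k) != 0.
Proof.
set e := young_symmetrizer n la; set A := stab_sum false _; set B := stab_sum true _.
move=> e0; apply: contraNneq e0 => eBA.
have eE : e = basis_vector 1 *m A *m B by apply: young_symmetrizerE.
have ee : e *m e^T = 0.
  rewrite {2}eE !trmx_mul !stab_sum_trmx !mulmxA -/A -/B.
  by rewrite eBA mul0mx.
have : \sum_k e 0 k * e 0 k = 0.
  transitivity ((e *m e^T) 0 0); last by rewrite ee mxE.
  by rewrite mxE; apply: eq_bigr => k _; rewrite [e^T _ _]mxE.
have eR k : e 0 k \is Num.real by apply: Rreal_int; apply: young_symmetrizer_int.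
move/eqP; rewrite psumr_eq0 => [|k _]; last by rewrite -expr2 real_exprn_even_ge0.
move/allP=> H; apply/eqP/rowP=> k; rewrite mxE.
by have := H k; rewrite mem_index_enum mulf_eq0 orbb => /(_ isT)/eqP.
Qed.

(** When w is constant on Y, the group Sym(Y) lies in the stabilizer of w, so it
    fixes (up to sign) every vector multiplied by [stab_sum b w].  Such a nonzero
    vector is the symmetrizer itself in the sign case, and e B A otherwise. *)
Lemma young_module_sum_neq0 la b (Y : {set 'I_n}) :
  young_symmetrizer n la != 0 ->
  {in Y &, forall k l : 'I_n, (if b then reshape_offset la k else reshape_index la k) =
     (if b then reshape_offset la l else reshape_index la l)} ->
  perm_on_sum (twist_repr b (specht_repr n la)) Y != 0.
Proof.
move=> e0 wY; rewrite /specht_repr submod_sum_eq0 -regular_perm_on_sumE.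
have sub (v : 'rV_nG) : (v <= cyclic_mx aG (young_symmetrizer n la))%MS ->
    v *m regular_perm_on_sum b Y != 0 ->
    cyclic_mx aG (young_symmetrizer n la) *m regular_perm_on_sum b Y != 0.
  by case/submxP=> D ->; apply: contraNneq; rewrite -mulmxA => ->; rewrite mulmx0.
have cyc c w (v : 'rV_nG) : (v <= cyclic_mx aG (young_symmetrizer n la))%MS ->
    (v *m stab_sum c w <= cyclic_mx aG (young_symmetrizer n la))%MS.
  move=> vU; rewrite /stab_sum mulmx_sumr summx_sub // => s _.
  rewrite -scalemxAr scalemx_sub // mxmodule_trans ?inE //.
  exact: cyclic_mx_module.
case: b wY sub => wY sub.
  apply: (sub _ (cyclic_mx_id _ _)); rewrite young_symmetrizerE.
  by apply: fixed_vector_sum wY _; rewrite -young_symmetrizerE.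
apply: (sub _ (cyc false (fun k => reshape_index la k) _
   (cyc true (fun k => reshape_offset la k) _ (cyclic_mx_id _ _)))).
by apply: fixed_vector_sum wY _; apply: young_symmetrizer_sandwich.
Qed.
End Specht.

(** * Irreducible characters of level d *)

Lemma partition_offset la k : sorted geq la -> (k < sumn la)%N ->
  (reshape_offset la k < head 0%N la)%N.
Proof.
move=> la_sorted kla; apply: leq_trans (reshape_offsetP kla) _.
have := reshape_indexP kla; rewrite -nth0; case: la la_sorted kla => [|x la] // srt _.
move=> ri; have geq_trans : transitive geq.
  by move=> a b c /= ba cb; apply: leq_trans cb ba.
exact: (sorted_leq_nth geq_trans leqnn 0%N srt 0%N _ _ ri (leq0n _)).
Qed.

Lemma partition_first_row n la : is_partition n la ->
  exists2 Y : {set 'I_n}, #|Y| = head 0%N la &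
    {in Y, forall k : 'I_n, reshape_index la k = 0%N}.
Proof.
case/and3P=> srt pos /eqP sn.
have lt (c : 'I_(head 0%N la)) : (flatten_index la 0 c < n)%N.
  by rewrite -sn; apply: flatten_indexP; rewrite nth0.
exists [set Ordinal (lt c) | c : 'I_(head 0%N la)].
  rewrite card_imset ?card_ord // => c c' /(congr1 val)/= E; apply: val_inj.
  by rewrite /= -(@flatten_indexKr la 0 c) ?nth0 // E flatten_indexKr ?nth0.
by move=> _ /imsetP[c _ ->] /=; apply: flatten_indexKl; rewrite nth0.
Qed.

Lemma partition_first_column n la : is_partition n la ->
  exists2 Y : {set 'I_n}, #|Y| = size la &
    {in Y, forall k : 'I_n, reshape_offset la k = 0%N}.
Proof.
case/and3P=> srt /allP pos /eqP sn.
have pr (r : 'I_(size la)) : (0 < nth 0%N la r)%N by apply: pos; apply: mem_nth.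
have lt (r : 'I_(size la)) : (flatten_index la r 0 < n)%N.
  by rewrite -sn; apply: flatten_indexP.
exists [set Ordinal (lt r) | r : 'I_(size la)].
  rewrite card_imset ?card_ord // => r r' /(congr1 val)/= E; apply: val_inj.
  by rewrite /= -(@flatten_indexKl la r 0) // E flatten_indexKl.
by move=> _ /imsetP[r _ ->] /=; apply: flatten_indexKr.
Qed.

(** The level is attained by the first row or by the first column; b records
    which, and chi times the corresponding linear character is a top level
    part. *)
Lemma specht_top_level n d (i : Iirr [set: 'S_n]) :
  has_level 'chi_i d -> (d + d <= n)%N ->
  exists b (j : Iirr [set: 'S_d]),
    forall g, top_level n d 'chi_j g = sgn_if b g * 'chi_i g.
Proof.
case=> la [pla chiE dE] ddn.
have e0 : young_symmetrizer n la != 0.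
  apply/negP => /eqP e0; have := irr1_neq0 i; rewrite chiE cfRepr1.
  by rewrite e0 (eqP (_ : cyclic_mx _ _ == 0)) ?cyclic_mx_eq0 // mxrank0 eqxx.
have [b Lb] : exists b, (if b then size la else head 0%N la) = (n - d)%N.
  have szn : (size la <= n)%N.
    have [Y <- _] := partition_first_column pla.
    by rewrite -[n in leqRHS]card_ord max_card.
  have hdn : (head 0%N la <= n)%N.
    have [Y <- _] := partition_first_row pla.
    by rewrite -[n in leqRHS]card_ord max_card.
  move: dE; rewrite /partition_level /minn; case: ifP => _ ->.
    by exists false; rewrite subKn.
  by exists true; rewrite subKn.
exists b.
have [srt pos /eqP sn] := and3P pla.
have [||| j jE] := @primitive_top_level n _ (twist_repr b (specht_repr n la)) d ddn.
- by rewrite cfnorm_twist -[cfRepr _]chiE cfnorm_irr.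
- move=> Y; apply: young_module_sum0 => k; case: b Lb => <-.
    by apply: reshape_indexP; rewrite sn.
  by apply: partition_offset; rewrite // sn.
- case: b Lb => <-.
    have [Y cY Y0] := partition_first_column pla; exists Y => //.
    by apply: young_module_sum_neq0 => // k l kY lY; rewrite !Y0.
  have [Y cY Y0] := partition_first_row pla; exists Y => //.
  by apply: young_module_sum_neq0 => // k l kY lY; rewrite !Y0.
by exists j => g; rewrite jE cfRepr_twist chiE.
Qed.

(** * The lower bound for character ratios *)

Lemma binom_ratio n f d : (d <= f)%N ->
  ((f - d) ^ d * 'C(n, d) <= n ^ d * 'C(f, d))%N.
Proof.
move=> df; rewrite -(leq_pmul2r (fact_gt0 d)) -!mulnA !bin_ffact mulnC.
have powE x : (x ^ d = \prod_(i < d) x)%N by rewrite prod_nat_const card_ord.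
apply: leq_mul; rewrite ffact_prod powE; apply: leq_prod => i _.
  by rewrite leq_subr.
by apply: leq_sub2l; apply: ltnW.
Qed.

(** Bounding by 2^d rather than by 2 keeps the case d = 0 exact. *)
Lemma one_sub_pow_ratio_le d : 2 - 2 ^+ d / 3 ^+ d <= 2 ^+ d :> algC.
Proof.
case: d => [|d]; first by rewrite !expr0 divr1 -[leLHS]/(1 + 1 - 1) addrK.
apply: (@le_trans _ _ 2); first by rewrite gerBl divr_ge0 ?exprn_ge0 ?ler0n.
by rewrite -natrX ler_nat expnS leq_pmulr ?expn_gt0.
Qed.

(** Up to sign, chi(sigma) and chi(1) are values of the same top level part, at
    two permutations without short cycles having f and n fixed points. *)
Lemma specht_ratio_ge n f d (sigma : 'S_n) (i : Iirr [set: 'S_n]) :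
  has_level 'chi_i d -> (4 * d <= f <= n)%N ->
  #|[set x | sigma x == x]| = f ->
  (forall x, sigma x != x -> (d < #|porbit sigma x|)%N) ->
  ((f - d)%:R / (3 * n)%:R) ^+ d <= `|'chi_i sigma / 'chi_i 1%g|.
Proof.
move=> lev /andP[df fn] fixE orbE.
have df1 : (d <= f)%N by apply: leq_trans df; rewrite leq_pmull.
have dn : (4 * d <= n)%N by apply: leq_trans fn.
have ddn : (d + d <= n)%N by lia.
have [b [j jE]] := specht_top_level lev ddn.
set psi : 'S_d -> algC := 'chi_j in jE.
set D := 'chi_j 1%g; have D0 : 0 < D by apply: irr1_gt0.
have psiN s : `|psi s| <= D by apply: char1_ge_norm; apply: irr_char.
have valS k (v : 'S_k -> algC) : (k <= d)%N ->
    ind_level n v sigma = 'C(f, k)%:R * v 1%g.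
  by move=> kd; rewrite (@ind_level_sparse n d) ?fixE.
have val1 k (v : 'S_k -> algC) : (k <= d)%N ->
    ind_level n v 1%g = 'C(n, k)%:R * v 1%g.
  move=> kd; rewrite (@ind_level_sparse n d) //; last by move=> x; rewrite perm1 eqxx.
  congr (_%:R * _); congr ('C(_, _)); rewrite -[RHS]card_ord -cardsT.
  by apply: eq_card => x; rewrite !inE perm1 eqxx.
have bS := top_level_bound valS df (leqnn d) (leqnn d) psiN.
have b1 := top_level_bound val1 dn (leqnn d) (leqnn d) psiN.
rewrite jE in bS; rewrite jE sgn_if1 mul1r in b1.
pose w : algC := 2 ^+ d / 3 ^+ d.
have chiS : w * ('C(f, d)%:R * D) <= `|'chi_i sigma|.
  have -> : `|'chi_i sigma| = `|sgn_if b sigma * 'chi_i sigma|.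
    by rewrite normrM /sgn_if normr_sign mul1r.
  have CD : `|'C(f, d)%:R * D| = 'C(f, d)%:R * D.
    by rewrite ger0_norm // mulr_ge0 ?ler0n // ltW.
  have := le_trans (lerB_dist ('C(f, d)%:R * D) (sgn_if b sigma * 'chi_i sigma)) _.
  rewrite distrC => /(_ _ bS); rewrite CD lerBlDr -lerBlDl.
  by apply: le_trans; rewrite mulrBl mul1r opprB addrC subrK.
have chi1 : `|'chi_i 1%g| <= 2 ^+ d * ('C(n, d)%:R * D).
  have CD : `|'C(n, d)%:R * D| = 'C(n, d)%:R * D.
    by rewrite ger0_norm // mulr_ge0 ?ler0n // ltW.
  have := le_trans (lerB_dist ('chi_i 1%g) ('C(n, d)%:R * D)) b1.
  rewrite CD lerBlDr => /le_trans; apply.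
  apply: (@le_trans _ _ ((2 - 2 ^+ d / 3 ^+ d) * ('C(n, d)%:R * D))); last first.
    by apply: ler_wpM2r (one_sub_pow_ratio_le d); rewrite mulr_ge0 ?ler0n // ltW.
  by rewrite -[leLHS]/((1 - w) * _ + _) -{2}[_ * D]mul1r -mulrDl addrAC -[1 + 1]/2.
have chi10 : 0 < `|'chi_i 1%g| by rewrite normr_gt0 irr1_neq0.
rewrite normrM normfV ler_pdivlMr //; apply: le_trans chiS.
apply: le_trans (ler_wpM2l _ chi1) _.
  by rewrite exprn_ge0 // divr_ge0 ?ler0n.
have [n0|n0] := posnP n.
  have d0 : d = 0%N by lia.
  by rewrite /w d0 !bin0 !expr0 divr1 !mul1r.
have nz : n%:R != 0 :> algC by rewrite pnatr_eq0 -lt0n.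
have -> : ((f - d)%:R / (3 * n)%:R) ^+ d * (2 ^+ d * ('C(n, d)%:R * D)) =
   w * ((((f - d) ^ d * 'C(n, d))%N%:R / n%:R ^+ d) * D).
  rewrite /w !natrM natrX exprMn exprVn exprMn; field.
  by rewrite !expf_neq0 // pnatr_eq0.
apply: ler_wpM2l; first by rewrite divr_ge0 ?exprn_ge0 ?ler0n.
apply: ler_wpM2r; first exact: ltW.
rewrite ler_pdivrMr ?exprn_gt0 ?ltr0n // mulrC -natrX -natrM ler_nat.
exact: binom_ratio.
Qed.

Lemma real_of_algC_ge (R : realType) (q : rat) (z : algC) :
  ratr q <= z -> z <= 1 -> ratr q <= real_of_algC R z.
Proof.
move=> qz z1; apply: ub_le_sup; last by exists q.
exists 1 => _ [p pz ->]; have : ratr p <= ratr 1 :> algC.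
  by rewrite rmorph1; apply: le_trans z1.
by rewrite ler_rat -(ler_rat R) rmorph1.
Qed.

(** * Growth estimates *)

Lemma powR_eventually (R : realType) (a B : R) : 0 < a ->
  exists n0 : nat, forall n : nat, (n0 <= n)%N -> B <= n%:R `^ a.
Proof.
move=> a0; pose C := `|B| `^ a^-1; exists (Num.truncn C).+1 => n nC.
have Cn : C <= n%:R.
  apply: ltW; apply: lt_le_trans (_ : (Num.truncn C).+1%:R <= _).
    by have /andP[] := truncn_itv (powR_ge0 `|B| a^-1).
  by rewrite ler_nat.
apply: le_trans (ler_norm B) _.
have -> : `|B| = C `^ a by rewrite -powRrM mulVf ?powRr1 // lt0r_neq0.
apply: ge0_ler_powR => //; first exact: ltW.
- by rewrite nnegrE powR_ge0.
- by rewrite nnegrE ler0n.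
Qed.

(** Write P = n^alpha.  The number of fixed points f = floor(2 alpha P) is at
    least 4 d for all the levels d considered.  The first largeness hypothesis
    gives 2 P <= n^((1 + alpha) / 2), hence f^f <= n^((1 + alpha) alpha P); the
    second gives n <= n^((1 - alpha) alpha P).  The product of these two bounds
    is exactly n^(2 alpha P). *)
Section Growth.
Variables (R : realType) (alpha : R) (n : nat).
Hypothesis alpha01 : 0 < alpha < 1.
Hypothesis n_gt0 : (0 < n)%N.
Hypothesis root_ge2 : 2 <= n%:R `^ ((1 - alpha) / 2).
Hypothesis pow_large : ((1 - alpha) * alpha)^-1 <= n%:R `^ alpha.

Let a0 : 0 < alpha. Proof. by case/andP: alpha01. Qed.
Let a1 : 0 < 1 - alpha. Proof. by case/andP: alpha01; rewrite subr_gt0. Qed.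
Let N := n%:R : R.
Let P := N `^ alpha.
Let G := N `^ ((1 + alpha) / 2).
Let f := Num.truncn (2 * alpha * P).

Let N0 : 0 < N. Proof. by rewrite ltr0n. Qed.
Let N1 : 1 <= N. Proof. by rewrite ler1n. Qed.
Let P0 : 0 < P. Proof. exact: powR_gt0. Qed.
Let aP : 1 <= (1 - alpha) * alpha * P.
Proof. by rewrite mulrC -ler_pdivrMr ?mulr_gt0 // div1r. Qed.
Let aP1 : 1 <= alpha * P.
Proof.
by apply: le_trans aP _; rewrite -mulrA ger_pMl ?mulr_gt0 // gerBl ltW.
Qed.

Lemma long_cycle_fix_le : f%:R <= 2 * alpha * P.
Proof. by rewrite truncn_le mulr_ge0 ?mulr_ge0 ?ltW. Qed.

Lemma long_cycle_fix_gt : 2 * alpha * P < f%:R + 1.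
Proof.
have /andP[_] := @truncn_itv _ (2 * alpha * P) (mulr_ge0 (mulr_ge0 (ler0n R 2) (ltW a0)) (ltW P0)).
by rewrite natr1.
Qed.

Lemma long_cycle_fix_leG : f%:R <= G.
Proof.
apply: le_trans long_cycle_fix_le _; apply: (@le_trans _ _ (2 * P)).
  by apply: ler_wpM2r; [exact: ltW|rewrite ger_pMr //; case/andP: alpha01 => _ /ltW].
apply: (@le_trans _ _ (N `^ ((1 - alpha) / 2) * P)).
  by apply: ler_wpM2r => //; exact: ltW.
rewrite /P -powRD; last by rewrite (gt_eqF N0) implybT.
by rewrite /G (_ : (1 - alpha) / 2 + alpha = (1 + alpha) / 2) //; field.
Qed.

Lemma long_cycle_fix_double : (2 * f <= n)%N.
Proof.
rewrite -(ler_nat R) natrM; apply: le_trans (ler_wpM2l _ long_cycle_fix_leG) _ => //.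
apply: le_trans (ler_wpM2r (powR_ge0 _ _) root_ge2) _.
rewrite -powRD; last by rewrite (gt_eqF N0) implybT.
have -> : (1 - alpha) / 2 + (1 + alpha) / 2 = 1 by field.
by rewrite powRr1 // ltW.
Qed.

Lemma long_cycle_fix_ge2 : (2 <= f)%N.
Proof.
rewrite truncn_ge_nat ?mulr_ge0 ?mulr_ge0 ?(ltW a0) ?(ltW P0) //.
by rewrite -mulrA ler_pMr.
Qed.

Lemma level_le_fix d : d%:R <= 2^-1 * alpha * P -> (4 * d <= f)%N.
Proof.
move=> dP; rewrite truncn_ge_nat ?mulr_ge0 ?mulr_ge0 ?(ltW a0) ?(ltW P0) //.
rewrite natrM; apply: le_trans (ler_wpM2l _ dP) _ => //.
by rewrite (_ : 4 * (2^-1 * alpha * P) = 2 * alpha * P) //; field.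
Qed.

Lemma centralizer_bound : (f ^ f * n)%N%:R <= N `^ (2 * alpha * P).
Proof.
have -> : 2 * alpha * P = (1 + alpha) / 2 * (2 * alpha * P) + (1 - alpha) * alpha * P.
  by field.
rewrite powRD; last by rewrite (gt_eqF N0) implybT.
rewrite natrM natrX; apply: ler_pM; rewrite ?exprn_ge0 ?ler0n //; last first.
  by rewrite -[leLHS](powRr1 (ltW N0)); apply: (ler_powR N1 aP).
apply: (@le_trans _ _ (G ^+ f)).
  by apply: lerXn2r; rewrite ?nnegrE ?powR_ge0 ?ler0n // long_cycle_fix_leG.
rewrite -powR_mulrn ?powR_ge0 // /G -powRrM; apply: (ler_powR N1).
apply: ler_wpM2l long_cycle_fix_le.
by rewrite divr_ge0 // addr_ge0 // ltW.
Qed.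

(** Since f - d >= 3 f / 4 and f > 2 alpha P - 1 >= alpha P, the base
    (f - d) / (3 n) is at least (alpha / 4) n^(alpha - 1). *)
Lemma ratio_bound d : (4 * d <= f)%N ->
  N `^ (d%:R * (alpha - 1)) * (4^-1 * alpha) ^+ d <=
  ((f - d)%:R / (3 * n)%:R) ^+ d.
Proof.
move=> df; rewrite [d%:R * _]mulrC powRrM powR_mulrn ?powR_ge0 // -exprMn.
apply: lerXn2r; rewrite ?nnegrE ?mulr_ge0 ?powR_ge0 ?invr_ge0 ?ler0n ?(ltW a0) //.
rewrite natrM ler_pdivlMr ?mulr_gt0 //.
have -> : N `^ (alpha - 1) * (4^-1 * alpha) * (3 * N) = 3 / 4 * (alpha * P).
  have -> : P = N * N `^ (alpha - 1) by rewrite mulr_powRB1 // ltW.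
  by field.
have d4 : 4 * d%:R <= f%:R :> R by rewrite -natrM ler_nat.
rewrite natrB; last by apply: leq_trans df; rewrite leq_pmull.
have := long_cycle_fix_gt; have := aP1; lra.
Qed.
End Growth.

Theorem theorem1p11 (R : realType) :
  exists c : R, 0 < c /\
  forall alpha : R, 0 < alpha < 1 ->
  exists n0 : nat, forall n : nat, (n0 <= n)%N ->
  exists sigma : 'S_n,
    #|(sigma ^: [set: 'S_n]%G)%g|%:R / (n`!)%:R
      >= n%:R `^ (- (2 * alpha * n%:R `^ alpha)) :> R
    /\
    forall (i : Iirr [set: 'S_n]%G) (d : nat),
      has_level 'chi_i d ->
      d%:R <= 2^-1 * alpha * n%:R `^ alpha ->
      real_of_algC R `|'chi_i sigma / 'chi_i 1%g|
        >= n%:R `^ (d%:R * (alpha - 1)) * (c * alpha) ^+ d.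
Proof.
exists 4^-1; split=> [|alpha alpha01]; first by rewrite invr_gt0.
have /andP[a0 a1] := alpha01.
have a1' : 0 < (1 - alpha) / 2 by rewrite divr_gt0 ?subr_gt0.
have [n1 H1] := @powR_eventually R _ 2 a1'.
have [n2 H2] := @powR_eventually R _ ((1 - alpha) * alpha)^-1 a0.
exists (maxn 1 (maxn n1 n2)) => n; rewrite !geq_max => /and3P[n0 /H1 big1' /H2 big2].
pose f := Num.truncn (2 * alpha * n%:R `^ alpha).
have f2 : (2 <= f)%N := long_cycle_fix_ge2 alpha01 n0 big2.
have fn : (2 * f <= n)%N := long_cycle_fix_double alpha01 n0 big1'.
have [|sigma [x0 [fixE cardE orbE]]] := @exists_long_cycle f n; first by lia.
exists sigma; split.
  have := card_class_long_cycle orbE; rewrite fixE => cl.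
  have := centralizer_bound alpha01 n0 big1' big2; rewrite -/f => cen.
  rewrite powRN ler_pdivlMr ?ltr0n ?fact_gt0 // mulrC ler_pdivrMr; last first.
    by rewrite powR_gt0 ?ltr0n.
  apply: le_trans (_ : (#|(sigma ^: [set: 'S_n]%G)%g| * (f ^ f * n))%N%:R <= _).
    by rewrite ler_nat.
  by rewrite natrM ler_wpM2l.
move=> i d lev dle; have df := level_le_fix alpha01 n0 dle.
apply: le_trans (ratio_bound alpha01 n0 big2 df) _.
have -> : ((f - d)%:R / (3 * n)%:R) ^+ d =
    ratr (((f - d)%:R / (3 * n)%:R) ^+ d) :> R.
  by rewrite rmorphXn /= fmorph_div /= !ratr_nat.
apply: real_of_algC_ge.
  rewrite rmorphXn /= fmorph_div /= !ratr_nat; apply: specht_ratio_ge lev _ fixE _.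
    by rewrite df; lia.
  move=> x /orbE ->; rewrite cardE; rewrite -/f in df; lia.
rewrite normrM normfV ler_pdivrMr ?normr_gt0 ?irr1_neq0 // mul1r.
rewrite [leRHS]ger0_norm ?char1_ge0 ?irr_char //.
by apply: char1_ge_norm; apply: irr_char.
Qed.
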